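(* Let $f:\mathbb{R}^{m_1}\times\mathbb{R}^{m_2}\to\mathbb{R}$ be a $C^1$ function of the form $f(x,y)=f_1(x)+f_2(y)$. Assume there are continuous functions $r_1,L_1:\mathbb{R}^{m_1}\to(0,\infty)$ and $r_2,L_2:\mathbb{R}^{m_2}\to(0,\infty)$ such that for every $x\in\mathbb{R}^{m_1}$ and $y\in\mathbb{R}^{m_2}$, $\nabla f_1$ is Lipschitz continuous on $B(x,r_1(x))$ with Lipschitz constant $L_1(x)$, and $\nabla f_2$ is Lipschitz continuous on $B(y,r_2(y))$ with Lipschitz constant $L_2(y)$. Assume moreover that $\nabla f$ is $C^2$ near the generalised saddle points of $f$. For $\delta_0>0$, $0<\alpha,\beta<1$ and an initial point $z_0=(x_0,y_0)$, let $\{z_n\}$ be the sequence constructed by Coordinate-wise Backtracking GD-New with the data $(r_1,L_1,r_2,L_2)$ and parameters $(\delta_0,\alpha,\beta)$. Then: (i) For every $\delta_0>0$, $0<\alpha,\beta<1$ and every $z_0$, either $\lim_{n\to\infty}\|z_{n+1}-z_n\|=0$ or $\lim_{n\to\infty}\|z_n\|=\infty$. Each cluster point of $\{z_n\}$ is a critical point of $f$. If moreover $f$ has at most countably many critical points, then either $\{z_n\}$ converges to a critical point of $f$ or $\lim_{n\to\infty}\|z_n\|=\infty$. (ii) For Lebesgue-almost every $(\delta_0,\alpha,\beta)\in(0,\infty)\times(0,1)\times(0,1)$, there is a set $\mathcal{E}_1\subset\mathbb{R}^{m_1}\times\mathbb{R}^{m_2}$ of Lebesgue measure $0$ such that for all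 $z_0\notin\mathcal{E}_1$, no cluster point of $\{z_n\}$ is an isolated generalised saddle point of $f$. (iii) Assume there is $L_0>0$ such that $\max\{L_1(x),L_2(y)\}\le L_0$ whenever $z=(x,y)$ is a non-isolated generalised saddle point of $f$. Then for Lebesgue-almost every $(\delta_0,\alpha,\beta)\in(0,\infty)\times(0,1)\times(0,1)$ with $\alpha/L_0\notin\{\beta^n\delta_0: n=0,1,2,\ldots\}$, there is a set $\mathcal{E}_2\subset\mathbb{R}^{m_1}\times\mathbb{R}^{m_2}$ of Lebesgue measure $0$ such that for all $z_0\notin\mathcal{E}_2$ the following holds: let $\{z'_n\}$ be the sequence starting at $z_0$ constructed by Coordinate-wise Backtracking GD-New with $L_1(x)$ replaced by $\max\{L_1(x),L_0\}$ and $L_2(y)$ replaced by $\max\{L_2(y),L_0\}$; if $\{z'_n\}$ converges, then its limit is not a generalised saddle point of $f$.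
   Context: Norms are Euclidean and $B(p,r)$ denotes the ball of centre $p$ and radius $r$. A critical point of a $C^1$ function is a point where its gradient vanishes. A cluster point of a sequence is the limit of some subsequence. A generalised saddle point of $f$ is a critical point $z_\infty$ of $f$ near which $f$ is $C^2$ and whose Hessian $\nabla^2 f(z_\infty)$ has at least one negative eigenvalue. It is isolated if it has a neighbourhood containing no other critical point of $f$, and non-isolated otherwise. Coordinate-wise Backtracking GD-New: given $(r_1,L_1,r_2,L_2)$, $\delta_0>0$ and $0<\alpha,\beta<1$, define $\delta_1(x)$ to be the largest number $\delta$ in $\{\beta^n\delta_0: n=0,1,2,\ldots\}$ satisfying both $$\delta<\alpha/L_1(x),\qquad \delta\,\|\nabla f_1(x)\|<r_1(x),$$ and define $\delta_2(y)$ to be the largest number $\delta$ in $\{\beta^n\delta_0: n=0,1,2,\ldots\}$ satisfying both $$\delta<\alpha/L_2(y),\qquad \delta\,\|\nabla f_2(y)\|<r_2(y).$$ Starting from $z_0=(x_0,y_0)$, define inductively $$z_{n+1}=(x_{n+1},y_{n+1})=\big(x_n-\delta_1(x_n)\nabla f_1(x_n),\;y_n-\delta_2(y_n)\nabla f_2(y_n)\big).$$ *)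

(* Defs.v *)
From HB Require Import structures.
From mathcomp Require Import all_boot all_order all_algebra.
From mathcomp Require Import all_classical all_reals all_analysis.

Set Implicit Arguments.
Unset Strict Implicit.
Unset Printing Implicit Defensive.
Import Order.TTheory GRing.Theory Num.Theory.
Import numFieldNormedType.Exports.

Local Open Scope classical_set_scope.
Local Open Scope ring_scope.

(* The library's norm on 'rV[R]_n is the sup norm. It induces the same topology
   as the Euclidean norm, so limits, continuity, neighbourhoods and
   differentiability are the library's; metric quantities use [enorm]. *)
Definition enorm (R : realType) (n : nat) (v : 'rV[R]_n) : R :=
  Num.sqrt (\sum_i v 0 i ^+ 2).

Definition eball (R : realType) (n : nat) (p : 'rV[R]_n) (r : R) :
  set 'rV[R]_n := [set x | enorm (x - p) < r].

Definition elipschitz_on (R : realType) (m n : nat) (A : set 'rV[R]_m) (L : R)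
    (g : 'rV[R]_m -> 'rV[R]_n) : Prop :=
  forall u v, A u -> A v -> enorm (g u - g v) <= L * enorm (u - v).

Definition partial (R : realType) (n : nat) (i : 'I_n) (f : 'rV[R]_n -> R) :
  'rV[R]_n -> R := fun x => 'D_(delta_mx 0 i) f x.

Definition grad (R : realType) (n : nat) (f : 'rV[R]_n -> R) (x : 'rV[R]_n) :
  'rV[R]_n := \row_i partial i f x.

Definition hessian (R : realType) (n : nat) (f : 'rV[R]_n -> R)
    (x : 'rV[R]_n) : 'M[R]_n :=
  \matrix_(i, j) partial j (partial i f) x.

(* Meant for U open: continuity and derivatives are those of the ambient
   space. *)
Fixpoint Ck_on (R : realType) (n : nat) (k : nat) (U : set 'rV[R]_n)
    (f : 'rV[R]_n -> R) : Prop :=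
  if k is k'.+1 then
    (forall x, U x -> differentiable f x) /\
    (forall i : 'I_n, Ck_on k' U (partial i f))
  else forall x, U x -> {for x, continuous f}.

Definition Ck_near (R : realType) (n : nat) (k : nat) (z : 'rV[R]_n)
    (f : 'rV[R]_n -> R) : Prop :=
  exists U : set 'rV[R]_n, [/\ open U, U z & Ck_on k U f].

Definition grad_Ck_near (R : realType) (n : nat) (k : nat) (z : 'rV[R]_n)
    (f : 'rV[R]_n -> R) : Prop :=
  exists U : set 'rV[R]_n,
    [/\ open U, U z & forall i : 'I_n, Ck_on k U (fun x => grad f x 0 i)].

Definition critical (R : realType) (n : nat) (f : 'rV[R]_n -> R)
    (z : 'rV[R]_n) : Prop := grad f z = 0.

Definition gen_saddle (R : realType) (n : nat) (f : 'rV[R]_n -> R)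
    (z : 'rV[R]_n) : Prop :=
  [/\ critical f z, Ck_near 2 z f &
      exists a : R, a < 0 /\ eigenvalue (hessian f z) a].

Definition isolated_critical (R : realType) (n : nat) (f : 'rV[R]_n -> R)
    (z : 'rV[R]_n) : Prop :=
  \forall w \near z, critical f w -> w = z.

Definition cluster_point (R : realType) (n : nat) (u : nat -> 'rV[R]_n)
    (p : 'rV[R]_n) : Prop :=
  exists phi : nat -> nat,
    {homo phi : i j / (i < j)%N} /\ u (phi k) @[k --> \oo] --> p.

Definition admissible_steps (R : realType) (n : nat) (f : 'rV[R]_n -> R)
    (r L : 'rV[R]_n -> R) (d0 a b : R) (x : 'rV[R]_n) : set R :=
  [set d | (exists k : nat, d = b ^+ k * d0) /\
           d < a / L x /\ d * enorm (grad f x) < r x].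

(* The largest admissible step (the default value 0 is only used when there
   is none). *)
Definition stepsize (R : realType) (n : nat) (f : 'rV[R]_n -> R)
    (r L : 'rV[R]_n -> R) (d0 a b : R) (x : 'rV[R]_n) : R :=
  let S := admissible_steps f r L d0 a b x in xget 0 (S `&` ubound S).

Definition gd_update (R : realType) (n : nat) (f : 'rV[R]_n -> R)
    (r L : 'rV[R]_n -> R) (d0 a b : R) (x : 'rV[R]_n) : 'rV[R]_n :=
  x - stepsize f r L d0 a b x *: grad f x.

(* R^m1 x R^m2 is 'rV[R]_(m1 + m2), the pair (x, y) being row_mx x y. *)
Definition cw_gd (R : realType) (m1 m2 : nat)
    (f1 : 'rV[R]_m1 -> R) (f2 : 'rV[R]_m2 -> R)
    (r1 L1 : 'rV[R]_m1 -> R) (r2 L2 : 'rV[R]_m2 -> R)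
    (d0 a b : R) (z0 : 'rV[R]_(m1 + m2)) (n : nat) : 'rV[R]_(m1 + m2) :=
  iter n (fun z => row_mx (gd_update f1 r1 L1 d0 a b (lsubmx z))
                          (gd_update f2 r2 L2 d0 a b (rsubmx z))) z0.

Definition box (R : realType) (n : nat) (c : 'rV[R]_n * 'rV[R]_n) :
  set 'rV[R]_n := [set x | forall i, c.1 0 i <= x 0 i <= c.2 0 i].

Definition box_volume (R : realType) (n : nat) (c : 'rV[R]_n * 'rV[R]_n) : R :=
  \prod_i Num.max 0 (c.2 0 i - c.1 0 i).

(* n-dimensional Lebesgue outer measure. The covers are indexed by an arbitrary
   D : set nat, so that they may be finite or empty: for n = 0 every box has
   volume 1. *)
Definition lebesgue_outer (R : realType) (n : nat) (A : set 'rV[R]_n) :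
    \bar R :=
  ereal_inf [set s : \bar R |
    exists (D : set nat) (c : nat -> 'rV[R]_n * 'rV[R]_n),
      A `<=` \bigcup_(k in D) box (c k) /\
      s = (\esum_(k in D) (box_volume (c k))%:E)%E].

Definition lebesgue_null (R : realType) (n : nat) (A : set 'rV[R]_n) : Prop :=
  lebesgue_outer A = 0%E.

(* For almost every (d0, a, b) in (0, oo) x (0, 1) x (0, 1). *)
Definition ae_params (R : realType) (P : R -> R -> R -> Prop) : Prop :=
  {ae ((@lebesgue_measure R \x @lebesgue_measure R) \x @lebesgue_measure R)%E,
    forall p, 0 < p.1.1 -> 0 < p.1.2 < 1 -> 0 < p.2 < 1 ->
      P p.1.1 p.1.2 p.2}.

(* Main.v *)
(* Near a saddle p with a / L p off the grid of step sizes the step is a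
   constant d, and the update map is C^1 with symmetric derivative
   A = 1 - d H, where an eigenvalue of A exceeds 1, say mu. For l in (1, mu^2)
   not an eigenvalue of A^2, the form q(D) = |D A|^2 - l |D|^2 satisfies
   q(D A) = l q(D) + |D (A^2 - l)|^2, and the surplus absorbs the nonlinear
   error, so q is multiplied by at least l along the difference of two orbits
   that stay near p. These orbits being bounded, q <= 0 on the differences of
   their starting points, which therefore form a Lipschitz graph over a
   hyperplane: a null set. No stable manifold theorem is involved. The update
   map is locally inverse-Lipschitz because d L < a < 1, so that preimages of
   null sets are null; countably many null sets cover the bad starting points.
   The exceptional parameters are those with a = c b^n d0 for a countable set of
   constants c. Convergence rests on the descent inequality, together with the
   fact that a sequence with vanishing steps that clusters at p without
   converging to p has a cluster point on every small sphere around p. *)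

Require Import Defs.
From HB Require Import structures.
From mathcomp Require Import all_boot all_order all_algebra.
From mathcomp Require Import all_classical all_reals all_analysis.
From mathcomp Require Import measurable_realfun ring lra.
Import Order.TTheory GRing.Theory Num.Theory.
Import numFieldNormedType.Exports.
Local Open Scope classical_set_scope.
Local Open Scope ring_scope.

Set Implicit Arguments.
Unset Strict Implicit.
Unset Printing Implicit Defensive.

(** * Euclidean norm *)

(** The obstacle is that the step size is discontinuous. Away from the saddles this is harmless: the
    steps lie on a countable grid, so preimages of null sets can be treated on one level set of the
    step size at a time. Separability makes the orbit a pair of independent orbits, one in each
    factor, and a negative eigenvalue of the block-diagonal Hessian belongs to one of the blocks;
    the dynamics is therefore studied for a single function, and its null set is pulled back to a
    cylinder. There may be uncountably many saddles, so the bad starting points are indexed by a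
    basic open set and a step exponent, not by saddles. Only resonance requires counting: isolated
    critical points are countable, and the constants c are the values of L_1 and L_2 at their
    components. At non-isolated saddles max(L_i, L_0) takes the single value L_0, which is where the
    condition on alpha / L_0 comes from. In (ii), an isolated critical point that is a cluster point
    is first shown to be the limit. *)

Definition dot (R : realType) (n : nat) (u v : 'rV[R]_n) : R :=
  (u *m v^T) 0 0.

Section Dot.
Variables (R : realType) (n : nat).
Implicit Types (u v w : 'rV[R]_n) (A : 'M[R]_n).

Lemma dotE u v : dot u v = \sum_i u 0 i * v 0 i.
Proof. by rewrite /dot mxE; apply: eq_bigr => i _; rewrite mxE. Qed.

Lemma dotC u v : dot u v = dot v u.
Proof. by rewrite !dotE; apply: eq_bigr => i _; rewrite mulrC. Qed.

Lemma dotDl u v w : dot (u + v) w = dot u w + dot v w.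
Proof. by rewrite /dot mulmxDl mxE. Qed.

Lemma dotDr u v w : dot u (v + w) = dot u v + dot u w.
Proof. by rewrite dotC dotDl ![dot _ u]dotC. Qed.

Lemma dotZl a u v : dot (a *: u) v = a * dot u v.
Proof. by rewrite /dot -scalemxAl mxE. Qed.

Lemma dotZr a u v : dot u (a *: v) = a * dot u v.
Proof. by rewrite dotC dotZl dotC. Qed.

Lemma dotNl u v : dot (- u) v = - dot u v.
Proof. by rewrite -scaleN1r dotZl mulN1r. Qed.

Lemma dotNr u v : dot u (- v) = - dot u v.
Proof. by rewrite dotC dotNl dotC. Qed.

Lemma dot_mulmx_sym A u v : A^T = A -> dot (u *m A) v = dot u (v *m A).
Proof. by move=> sA; rewrite /dot trmx_mul sA mulmxA. Qed.

Lemma dot_ge0 u : 0 <= dot u u.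
Proof. by rewrite dotE sumr_ge0// => i _; rewrite -expr2 sqr_ge0. Qed.

Lemma enorm_ge0 u : 0 <= enorm u.
Proof. exact: sqrtr_ge0. Qed.

Lemma enorm_sqr u : enorm u ^+ 2 = dot u u.
Proof.
rewrite /enorm sqr_sqrtr; last by rewrite sumr_ge0// => i _; rewrite sqr_ge0.
by rewrite dotE; apply: eq_bigr => i _; rewrite expr2.
Qed.

Lemma coord_le_enorm u i : `|u 0 i| <= enorm u.
Proof.
rewrite -(@ler_sqr R) ?nnegrE ?enorm_ge0 ?normr_ge0//.
rewrite enorm_sqr dotE real_normK ?num_real// (bigD1 i)//= -expr2 lerDl.
by rewrite sumr_ge0// => j _; rewrite -expr2 sqr_ge0.
Qed.

Lemma enorm_eq0 u : (enorm u == 0) = (u == 0).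
Proof.
apply/eqP/eqP => [u0|->].
  apply/rowP => i; rewrite mxE; apply/eqP; rewrite -normr_le0.
  by have := coord_le_enorm u i; rewrite u0.
by apply/eqP; rewrite -sqrf_eq0 enorm_sqr dotE big1// => i _; rewrite mxE mul0r.
Qed.

Lemma enorm0 : enorm (0 : 'rV[R]_n) = 0.
Proof. by apply/eqP; rewrite enorm_eq0. Qed.

(** Cauchy-Schwarz: with a = |u| and b = |v|, the square of |b u - a v| is 2ab(ab - u.v), and 2ab
    can be divided out. *)
Lemma dot_le_enorm u v : dot u v <= enorm u * enorm v.
Proof.
have [->|u0] := eqVneq u 0.
  by rewrite enorm0 mul0r /dot mul0mx mxE.
have [->|v0] := eqVneq v 0.
  by rewrite enorm0 mulr0 dotC /dot mul0mx mxE.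
set a := enorm u; set b := enorm v.
have a0 : 0 < a by rewrite lt0r enorm_eq0 u0 enorm_ge0.
have b0 : 0 < b by rewrite lt0r enorm_eq0 v0 enorm_ge0.
have := dot_ge0 (b *: u - a *: v).
rewrite dotDl !dotDr !dotNl !dotNr !dotZl !dotZr -!enorm_sqr (dotC v u) -/a -/b.
set d := dot u v => h.
have {}h : 0 <= 2 * (a * b) * (a * b - d) by lra.
by rewrite -subr_ge0 -(@pmulr_rge0 _ (2 * (a * b))) ?mulr_gt0.
Qed.

Lemma enormN u : enorm (- u) = enorm u.
Proof.
by rewrite /enorm; congr Num.sqrt; apply: eq_bigr => i _; rewrite mxE sqrrN.
Qed.

Lemma enormBC u v : enorm (u - v) = enorm (v - u).
Proof. by rewrite -enormN opprB. Qed.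

Lemma norm_dot_le u v : `|dot u v| <= enorm u * enorm v.
Proof.
by rewrite ler_norml dot_le_enorm andbT lerNl -dotNl -(enormN u) dot_le_enorm.
Qed.

Lemma enormZ a u : enorm (a *: u) = `|a| * enorm u.
Proof.
apply/eqP; rewrite -(@eqrXn2 R 2)// ?mulr_ge0 ?enorm_ge0//.
by rewrite exprMn !enorm_sqr dotZl dotZr mulrA -expr2 real_normK ?num_real.
Qed.

Lemma enormD u v : enorm (u + v) <= enorm u + enorm v.
Proof.
rewrite -(@ler_sqr R) ?nnegrE ?addr_ge0 ?enorm_ge0// sqrrD !enorm_sqr.
rewrite dotDl !dotDr (dotC v u).
have := dot_le_enorm u v; lra.
Qed.

Lemma ler_enormB u v : enorm (u - v) <= enorm u + enorm v.
Proof. by rewrite (le_trans (enormD _ _))// enormN. Qed.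

Lemma lerB_enormD u v : enorm u - enorm v <= enorm (u + v).
Proof. by have := ler_enormB (u + v) v; rewrite addrK; lra. Qed.

Lemma enorm_le_sum u : enorm u <= \sum_i `|u 0 i|.
Proof.
rewrite -(@ler_sqr R) ?nnegrE ?enorm_ge0 ?sumr_ge0//.
rewrite enorm_sqr dotE expr2 mulr_suml; apply: ler_sum => i _.
rewrite -expr2 -real_normK ?num_real// expr2 ler_wpM2l//.
by rewrite (bigD1 i)//= lerDl sumr_ge0.
Qed.

Lemma enorm_le_coords u (b : R) :
  (forall i, `|u 0 i| <= b) -> enorm u <= n%:R * b.
Proof.
move=> ub; apply: (le_trans (enorm_le_sum u)).
apply: (le_trans (ler_sum _ (fun i _ => ub i))).
by rewrite sumr_const card_ord mulr_natl.
Qed.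

Lemma coord_le_norm u i : `|u 0 i| <= `|u|.
Proof.
rewrite [X in _ <= X]/Num.norm/= mx_normrE.
exact: (le_bigmax _ (fun k : 'I_1 * 'I_n => `|u k.1 k.2|) (0, i)).
Qed.

Lemma norm_le_coords u (b : R) : 0 <= b ->
  (forall i, `|u 0 i| <= b) -> `|u| <= b.
Proof.
move=> b0 ub; rewrite [X in X <= _]/Num.norm/= mx_normrE.
by apply/bigmax_leP; split=> // -[i j] _ /=; rewrite (ord1 i).
Qed.

Lemma norm_le_enorm u : `|u| <= enorm u.
Proof. by apply: norm_le_coords => [|i]; [exact: enorm_ge0|exact: coord_le_enorm]. Qed.

Lemma enorm_le_norm u : enorm u <= n%:R * `|u|.
Proof. by apply: enorm_le_coords => i; exact: coord_le_norm. Qed.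

(** The factor [n.+1] stays positive in dimension 0, so radii can be divided by it. *)
Lemma enorm_lt_norm u : enorm u <= n.+1%:R * `|u|.
Proof.
by apply: (le_trans (enorm_le_norm u)); rewrite ler_wpM2r// ler_nat.
Qed.

Lemma nbhs_eball (p : 'rV[R]_n) (r : R) : 0 < r -> nbhs p (eball p r).
Proof.
move=> r0; apply/nbhs_ballP; exists (r / n.+1%:R) => /=; first by rewrite divr_gt0.
move=> x; rewrite -ball_normE /= => xp; rewrite /eball /= enormBC.
by apply: (le_lt_trans (enorm_lt_norm _)); rewrite mulrC -ltr_pdivlMr.
Qed.

Lemma nbhs_eballP (p : 'rV[R]_n) (U : set 'rV[R]_n) :
  nbhs p U -> exists2 r : R, 0 < r & eball p r `<=` U.
Proof.
move=> /nbhs_ballP[r /= r0 rU]; exists r => // x xp; apply: rU.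
rewrite -ball_normE /=; apply: le_lt_trans xp.
by rewrite enormBC norm_le_enorm.
Qed.

Lemma continuous_enorm : continuous (@enorm R n).
Proof.
move=> p; apply/(@cvgrPdist_lt _ _ _ (nbhs p)) => e e0;
  apply: filterS (nbhs_eball p e0) => x.
rewrite /eball/=; apply: le_lt_trans.
have h1 := lerB_enormD p (x - p); have h2 := lerB_enormD x (p - x).
rewrite subrKC in h1; rewrite subrKC in h2; rewrite enormBC in h2.
by rewrite ler_norml; lra.
Qed.

End Dot.

Lemma mulmx_enorm_bound (R : realType) (m n : nat) (A : 'M[R]_(m, n)) :
  exists2 K : R, 0 < K & forall u : 'rV[R]_m, enorm (u *m A) <= K * enorm u.
Proof.
(* The added 1 keeps the constant positive when [A] is zero or empty. *)
exists (1 + \sum_i \sum_j `|A j i|).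
  by rewrite ltr_pwDl// !sumr_ge0// => i _; rewrite sumr_ge0.
move=> u; apply: (le_trans (enorm_le_sum _)).
rewrite mulrDl mul1r (@le_trans _ _ (\sum_i \sum_j `|A j i| * enorm u))//.
  apply: ler_sum => i _; rewrite mxE; apply: (le_trans (ler_norm_sum _ _ _)).
  by apply: ler_sum => j _; rewrite normrM mulrC ler_wpM2l// coord_le_enorm.
rewrite mulr_suml (_ : \sum_i _ = \sum_i (\sum_j `|A j i|) * enorm u).
  by rewrite lerDr enorm_ge0.
by apply: eq_bigr => i _; rewrite mulr_suml.
Qed.

Lemma mulmx_continuous (R : realType) (m n : nat) (A : 'M[R]_(m, n)) :
  continuous (fun x : 'rV[R]_m => x *m A).
Proof.
have [K K0 HK] := mulmx_enorm_bound A.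
move=> p; apply/(@cvgrPdist_lt _ _ _ (nbhs p)) => e e0.
apply: filterS (nbhs_eball p (divr_gt0 e0 K0)) => x.
rewrite /eball /= enormBC ltr_pdivlMr// mulrC; apply: le_lt_trans.
by rewrite -mulmxBl (le_trans (norm_le_enorm _)).
Qed.

(** * Descent and step sizes *)

Section Calculus.
Variables (R : realType) (n : nat).
Implicit Types (f : 'rV[R]_n -> R) (x v : 'rV[R]_n).

Lemma derive_dot f x v : differentiable f x -> 'D_v f x = dot v (grad f x).
Proof.
move=> df; rewrite deriveE// {1}[v]row_sum_delta linear_sum dotE.
apply: eq_bigr => i _; rewrite linearZ /= mxE /partial deriveE//.
Qed.

Lemma is_derive_line f x v (t : R) : differentiable f (x + t *: v) ->
  is_derive t 1 (fun s => f (x + s *: v)) (dot v (grad f (x + t *: v))).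
Proof.
move=> df; have dv : derivable f (x + t *: v) v by exact: diff_derivable.
have E : (fun s : R => s^-1 *: (f (x + (s *: 1 + t) *: v) - f (x + t *: v))) =
         (fun s : R => s^-1 *: (f (s *: v + (x + t *: v)) - f (x + t *: v))).
  apply/funext => s; congr (_ *: (f _ - _)).
  by rewrite scalerDl addrCA [s *: 1]mulr1.
apply: DeriveDef; first by rewrite /derivable; move: dv; rewrite /derivable -E.
by rewrite -derive_dot// /derive -E.
Qed.

Lemma mvt_segment f x v :
  (forall t : R, 0 <= t <= 1 -> differentiable f (x + t *: v)) ->
  exists2 t : R, 0 < t < 1 & f (x + v) - f x = dot v (grad f (x + t *: v)).
Proof.
move=> df.
have [t||c c01] := @MVT R (fun s => f (x + s *: v))
   (fun s => dot v (grad f (x + s *: v))) 0 1 ltr01.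
- rewrite in_itv/= => /andP[t0 t1]; apply: is_derive_line.
  by apply: df; rewrite !ltW.
- apply: derivable_within_continuous => t; rewrite in_itv/= => t01.
  by case: (is_derive_line (df t t01)).
rewrite scale1r scale0r addr0 subr0 mulr1 => ->; exists c => //.
Qed.

Lemma row_continuous (T : topologicalType) (g : T -> 'rV[R]_n) (p : T) :
  (forall i, {for p, continuous (fun t => g t 0 i)}) -> {for p, continuous g}.
Proof.
move=> gc; apply/(@cvgrPdist_lt _ _ _ (nbhs p)) => e e0.
have e20 : 0 < e / 2 by rewrite divr_gt0.
have : \forall t \near p, forall i, `|g p 0 i - g t 0 i| < e / 2.
  apply: filter_forall => i.
  by have /(@cvgrPdist_lt _ _ _ (nbhs p)) /(_ _ e20) := gc i.
apply: filterS => x gx; apply: (@le_lt_trans _ _ (e / 2)); last by lra.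
apply: norm_le_coords => [|i]; first exact: ltW.
by rewrite !mxE ltW.
Qed.

Lemma C1_differentiable f x : Ck_on 1 setT f -> differentiable f x.
Proof. by case=> df _; exact: df. Qed.

Lemma C1_grad_continuous f : Ck_on 1 setT f -> continuous (grad f).
Proof.
case=> _ cf p; apply: row_continuous => i.
rewrite (_ : (fun x => _) = partial i f); first exact: cf.
by apply/funext => x; rewrite mxE.
Qed.

(** By the mean value theorem the decrease is d g.grad f(y) for some y on the step, and the
    Lipschitz bound puts grad f(y) within L d |g| of g. This loses a fraction d L <= a. Integration
    would halve the loss, but any positive factor serves here. *)
Lemma gradient_descent f x (r L a d : R) :
  (forall y, differentiable f y) -> elipschitz_on (eball x r) L (grad f) ->
  0 <= d -> 0 <= L -> d * L <= a -> d * enorm (grad f x) < r ->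
  f (x - d *: grad f x) <= f x - (1 - a) * (d * enorm (grad f x) ^+ 2).
Proof.
move=> df lip d0 L0 dLa dr; set g := grad f x in dr *.
have r0 : 0 < r by apply: le_lt_trans dr; rewrite mulr_ge0// enorm_ge0.
have [t /andP[t0 t1]] := @mvt_segment f x (- (d *: g)) (fun t _ => df _).
set y := x + t *: _ => fy; rewrite -lerBlDl fy.
have yx : enorm (y - x) = t * (d * enorm g).
  by rewrite /y addrAC subrr add0r enormZ enormN enormZ !ger0_norm// ltW.
have yxd : enorm (y - x) <= d * enorm g.
  by rewrite yx ler_piMl ?mulr_ge0 ?enorm_ge0// ltW.
have xr : eball x r x by rewrite /eball/= subrr enorm0.
have hl := lip y x (le_lt_trans yxd dr) xr.
have -> : dot (- (d *: g)) (grad f y) =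
    - (d * enorm g ^+ 2) - d * dot g (grad f y - g).
  by rewrite enorm_sqr dotNl dotZl dotDr dotNr; ring.
have h1 : - dot g (grad f y - g) <= enorm g * (L * (d * enorm g)).
  rewrite -dotNl; apply: (le_trans (dot_le_enorm _ _)).
  rewrite enormN ler_wpM2l ?enorm_ge0//; apply: (le_trans hl).
  by rewrite ler_wpM2l.
have h2 : d * - dot g (grad f y - g) <= d * (enorm g * (L * (d * enorm g))).
  by rewrite ler_wpM2l.
have h3 : d * enorm g ^+ 2 * (d * L) <= d * enorm g ^+ 2 * a.
  by rewrite ler_wpM2l// mulr_ge0// exprn_ge0// enorm_ge0.
lra.
Qed.

End Calculus.

Section Stepsize.
Variables (R : realType) (n : nat) (f : 'rV[R]_n -> R) (r L : 'rV[R]_n -> R).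
Variables (d0 a b : R).
Hypotheses (r_gt0 : forall x, 0 < r x) (L_gt0 : forall x, 0 < L x).
Hypotheses (d0_gt0 : 0 < d0) (a01 : 0 < a < 1) (b01 : 0 < b < 1).

Let adm x (d : R) := d < a / L x /\ d * enorm (grad f x) < r x.

Let b_gt0 : 0 < b. Proof. by case/andP: b01. Qed.

Lemma geometric_small (e : R) : 0 < e -> exists k : nat, b ^+ k * d0 < e.
Proof.
move=> e0; have bk : (fun k : nat => b ^+ k) @ \oo --> (0 : R).
  by apply: cvg_expr; rewrite gtr0_norm//; case/andP: b01.
have /cvgrPdist_lt/(_ (e / d0)) := bk; rewrite divr_gt0// => /(_ erefl) [k _ bke].
exists k; have := bke k (leqnn k) => /=.
by rewrite sub0r normrN gtr0_norm ?exprn_gt0// ltr_pdivlMr.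
Qed.

Let geom_le (j k : nat) : (j <= k)%N -> b ^+ k * d0 <= b ^+ j * d0.
Proof.
move=> jk; rewrite ler_pM2r//; case/andP: b01 => ? ?.
by rewrite ler_wiXn2l// ltW.
Qed.

(** The grid decreases with the exponent, so the largest admissible step has the least admissible
    exponent. *)
Lemma stepsize_unique x (k : nat) : adm x (b ^+ k * d0) ->
  (forall j, (j < k)%N -> ~ adm x (b ^+ j * d0)) ->
  stepsize f r L d0 a b x = b ^+ k * d0.
Proof.
move=> ak nj; rewrite /stepsize /=; apply: xget_unique.
- split; first by split; [exists k|].
  move=> d [[j ->] aj]; apply: geom_le; rewrite leqNgt; apply/negP => jk.
  exact: nj aj.
- move=> y [[[j ->] aj] yub]; apply/eqP; rewrite eq_le; apply/andP; split.
  + apply: geom_le; rewrite leqNgt; apply/negP => jk; exact: nj aj.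
  + by apply: yub; split; [exists k|].
Qed.

Lemma stepsizeP x : exists k : nat, [/\ stepsize f r L d0 a b x = b ^+ k * d0,
  adm x (b ^+ k * d0) & forall j, (j < k)%N -> ~ adm x (b ^+ j * d0)].
Proof.
have ex : exists k : nat, `[< adm x (b ^+ k * d0) >].
  (* The 1 in the denominator covers a vanishing gradient. *)
  have h : 0 < Num.min (a / L x) (r x / (1 + enorm (grad f x))).
    case/andP: a01 => a0 _.
    by rewrite lt_min !divr_gt0// ltr_pwDl// enorm_ge0.
  have [k] := geometric_small h; rewrite lt_min => /andP[h1 h2]; exists k.
  apply/asboolP; split => //; apply: le_lt_trans; last first.
    by rewrite ltr_pdivlMr in h2; [exact: h2|rewrite ltr_pwDl// enorm_ge0].
  rewrite ler_wpM2l ?lerDr// mulr_ge0 ?exprn_ge0 ?ltW//.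
have := ex_minnP ex => -[k /asboolP ak mk].
have nj : forall j, (j < k)%N -> ~ adm x (b ^+ j * d0).
  by move=> j jk aj; have := mk j; rewrite leqNgt jk => /(_ (asboolT aj)).
by exists k; split => //; exact: stepsize_unique.
Qed.

Lemma stepsize_gt0 x : 0 < stepsize f r L d0 a b x.
Proof. by have [k [-> _ _]] := stepsizeP x; rewrite mulr_gt0// exprn_gt0. Qed.

Lemma stepsize_le x : stepsize f r L d0 a b x <= d0.
Proof.
have [k [-> _ _]] := stepsizeP x.
by rewrite -[leRHS]mul1r -(expr0 b) geom_le.
Qed.

Lemma stepsize_lt_L x : stepsize f r L d0 a b x * L x < a.
Proof. by have [k [-> [h _] _]] := stepsizeP x; rewrite -ltr_pdivlMr. Qed.

Lemma stepsize_lt_r x : stepsize f r L d0 a b x * enorm (grad f x) < r x.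
Proof. by have [k [-> [_ h] _]] := stepsizeP x. Qed.

Hypotheses (r_cont : continuous r) (L_cont : continuous L).
Hypothesis g_cont : continuous (grad f).

Let gn_cont : continuous (fun x => enorm (grad f x)).
Proof.
move=> x; apply: (@continuous_comp _ _ _ (grad f) (@enorm R n)).
  exact: g_cont.
exact: continuous_enorm.
Qed.

Let aL_cont (p : 'rV[R]_n) : {for p, continuous (fun x => a / L x)}.
Proof.
apply: continuousM; first exact: cst_continuous.
by apply: continuousV; [rewrite gt_eqF|exact: L_cont].
Qed.

Let near_gt0 (h : 'rV[R]_n -> R) (p : 'rV[R]_n) : {for p, continuous h} -> 0 < h p ->
  \forall x \near p, 0 < h x.
Proof.
move=> hc h0; have /(@cvgrPdist_lt _ _ _ (nbhs p))/(_ _ h0) := hc.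
by apply: filterS => x; rewrite ltr_norml; lra.
Qed.

Let near_adm (p : 'rV[R]_n) (d : R) : adm p d -> \forall x \near p, adm x d.
Proof.
move=> [h1 h2].
have c1 : {for p, continuous (fun x : 'rV[R]_n => a / L x - d)}.
  by apply: continuousB; [exact: aL_cont|exact: cst_continuous].
have c2 : {for p, continuous (fun x => r x - d * enorm (grad f x))}.
  apply: continuousB; first exact: r_cont.
  by apply: continuousM; [exact: cst_continuous|exact: gn_cont].
have := near_gt0 c2; rewrite subr_gt0 => /(_ h2).
have := near_gt0 c1; rewrite subr_gt0 => /(_ h1).
by apply: filterS2 => x; rewrite !subr_gt0.
Qed.

(** Admissibility of a fixed step is an open condition: the step chosen at [p] remains a candidate
    near [p], where the maximum can only be larger. *)
Lemma stepsize_locally_bounded_below (p : 'rV[R]_n) :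
  exists2 e : R, 0 < e & \forall x \near p, e <= stepsize f r L d0 a b x.
Proof.
have [k [_ ak _]] := stepsizeP p; exists (b ^+ k * d0).
  by rewrite mulr_gt0// exprn_gt0.
apply: filterS (near_adm ak) => x akx; have [j [-> _ nj]] := stepsizeP x.
by apply: geom_le; rewrite leqNgt; apply/negP => /nj; exact.
Qed.

(** At a critical point the gradient condition is vacuous, so the next larger grid step was rejected
    because of a / L alone. Non-resonance makes that rejection strict; hence it persists near [p],
    as does the acceptance of the chosen step. *)
Lemma stepsize_locally_constant (p : 'rV[R]_n) : critical f p ->
  (forall k : nat, a / L p <> b ^+ k * d0) ->
  exists d : R, [/\ 0 < d, d * L p < a &
    \forall x \near p, stepsize f r L d0 a b x = d].
Proof.
move=> cp nr; have [k [sk ak nj]] := stepsizeP p; exists (b ^+ k * d0).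
split; first by rewrite mulr_gt0// exprn_gt0.
  by rewrite -sk stepsize_lt_L.
case: k => [|k] in sk ak nj *.
  apply: filterS (near_adm ak) => x akx; exact: stepsize_unique.
have hk : a / L p < b ^+ k * d0.
  rewrite lt_neqAle; apply/andP; split; first exact/eqP.
  rewrite leNgt; apply/negP => h; apply: (nj k) => //; split => //.
  by rewrite cp enorm0 mulr0.
have c1 : {for p, continuous (fun x : 'rV[R]_n => b ^+ k * d0 - a / L x)}.
  by apply: continuousB; [exact: cst_continuous|exact: aL_cont].
have := near_gt0 c1; rewrite subr_gt0 => /(_ hk) h.
have := near_adm ak; move: h; apply: filterS2 => x; rewrite subr_gt0 => hx akx.
apply: stepsize_unique => // j; rewrite ltnS => /geom_le jk [+ _].
by move: hx jk; lra.
Qed.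

End Stepsize.

(** * Null sets *)

(** Abstract in the covering sets and their weights, so that cubes (suited to preimages) and boxes
    (which define the outer measure) share one theory. *)
Definition cover_null (R : realType) (T I : Type) (S : I -> set T)
    (w : I -> R) (A : set T) : Prop :=
  forall e : R, 0 < e -> exists (D : set nat) (c : nat -> I),
    A `<=` \bigcup_(k in D) S (c k) /\
    (\esum_(k in D) (w (c k))%:E <= e%:E)%E.

Section CoverNull.
Variables (R : realType) (T I : Type) (S : I -> set T) (w : I -> R).
Hypothesis w_ge0 : forall i, 0 <= w i.

Lemma cover_null_sub (A B : set T) :
  A `<=` B -> cover_null S w B -> cover_null S w A.
Proof.
by move=> AB nB e /nB [D [c [Bc ce]]]; exists D, c; split => // x /AB /Bc.
Qed.

(** Brings covers indexed by pairs or by a finite type back to [nat]. The default [i0] sits only at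
    numbers that code nothing, which [D'] leaves out. *)
Lemma countable_cover_nat (J : countType) (D : set J) (c : J -> I) (i0 : I) :
  exists (D' : set nat) (c' : nat -> I),
    (forall j, D j -> D' (pickle j) /\ c' (pickle j) = c j) /\
    \esum_(k in D') (w (c' k))%:E = \esum_(j in D) (w (c j))%:E.
Proof.
exists (pickle @` D), (fun k => if unpickle k is Some j then c j else i0).
split; first by move=> j Dj; split; [exists j|rewrite pickleK].
rewrite (reindex_esum D _ pickle).
  by apply: eq_esum => j _; rewrite pickleK.
split.
- by move=> j Dj; exists j.
- by move=> x y _ _ /(pcan_inj pickleK).
- by move=> _ [j Dj <-]; exists j.
Qed.

Lemma cover_null_bigcup (A : nat -> set T) :
  (forall k, cover_null S w (A k)) -> cover_null S w (\bigcup_k A k).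
Proof.
move=> nA e e0.
have ek k : 0 < e / (2 ^ k.+1)%:R by rewrite divr_gt0// ltr0n expn_gt0.
have /choice[F HF] k : exists Dc : set nat * (nat -> I),
    A k `<=` \bigcup_(j in Dc.1) S (Dc.2 j) /\
    (\esum_(j in Dc.1) (w (Dc.2 j))%:E <= (e / (2 ^ k.+1)%:R)%:E)%E.
  by have [D [c Dc]] := nA k _ (ek k); exists (D, c).
pose D := [set: nat] `*`` (fun k => (F k).1).
have [D' [c' [DD' ce]]] :=
  countable_cover_nat D (fun p => (F p.1).2 p.2) ((F 0%N).2 0%N).
exists D', c'; split.
  move=> x [k _ Akx]; have [/(_ x Akx) [j Dj Sx] _] := HF k.
  have [Dp cp] := DD' (k, j) (conj Logic.I Dj).
  by exists (pickle (k, j)) => //; rewrite cp.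
rewrite ce /D -(@esum_esum _ _ _ _ _ (fun k j => (w ((F k).2 j))%:E)); last first.
  by move=> i j _ _; rewrite lee_fin.
apply: (@le_trans _ _ (\esum_(k in [set: nat]) (e / (2 ^ k.+1)%:R)%:E)).
  by apply: le_esum => k _; case: (HF k).
rewrite -nneseries_esumT; last by move=> k; rewrite lee_fin ltW.
exact/epsilon_trick0/ltW.
Qed.

Lemma cover_null_finite (i0 : I) (A : set T) :
  (forall e : R, 0 < e -> exists (J : finType) (P : {pred J}) (c : J -> I),
    A `<=` \bigcup_(j in [set` P]) S (c j) /\ \sum_(j in P) w (c j) <= e) ->
  cover_null S w A.
Proof.
move=> fA e /fA [J [P [c [Ac ce]]]].
have [D' [c' [DD' eD]]] := countable_cover_nat [set` P] c i0.
exists D', c'; split.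
  by move=> x /Ac [j /DD' [Dj cj] Sx]; exists (pickle j) => //; rewrite cj.
rewrite eD esum_fset//; last by move=> j _; rewrite lee_fin.
have -> : [set` P] = [set` enum P].
  by apply/seteqP; split => j /=; rewrite mem_enum.
by rewrite -fsbig_seq ?enum_uniq// sumEFin lee_fin big_enum.
Qed.

End CoverNull.

(** Only the part of each preimage inside [A'] must fit in one covering set. Thus [phi] may be
    inverse-Lipschitz on [A'] only, or may forget coordinates in which [A'] is bounded. *)
Lemma cover_null_transfer (R : realType) (T T' I I' : Type) (S : I -> set T)
    (S' : I' -> set T') (w : I -> R) (w' : I' -> R) (phi : T' -> T) (K : R)
    (A : set T) (A' : set T') : 0 < K -> (forall i, 0 <= w i) ->
  (forall i, exists i', A' `&` phi @^-1` S i `<=` S' i' /\ w' i' <= K * w i) ->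
  A' `<=` phi @^-1` A -> cover_null S w A -> cover_null S' w' A'.
Proof.
move=> K0 w0 /choice[h Hh] A'A nA e e0.
have [D [c [Ac ce]]] := nA (e / K) (divr_gt0 e0 K0); exists D, (h \o c).
split.
  move=> x A'x; have [k Dk Sx] := Ac _ (A'A _ A'x); exists k => //=.
  by have [+ _] := Hh (c k); apply.
apply: ge_ereal_sup => _ [F [finF FD] <-].
apply: (@le_trans _ _ (\sum_(k \in F) (K%:E * (w (c k))%:E)%E)%R).
  by apply: lee_fsum => // k _; rewrite -EFinM lee_fin; have [] := Hh (c k).
rewrite -ge0_mule_fsumr//; last by move=> k; rewrite lee_fin.
rewrite (_ : e = K * (e / K)); last by rewrite mulrC divfK ?gt_eqF.
rewrite EFinM; apply: lee_wpmul2l; first by rewrite lee_fin ltW.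
by apply: le_trans ce; apply: esum_ge; exists F.
Qed.

Definition cube (R : realType) (n : nat) (c : 'rV[R]_n * R) : set 'rV[R]_n :=
  [set x | forall i, `|x 0 i - c.1 0 i| <= c.2].

(* Cubes rather than boxes: the preimage of a cube under an inverse-Lipschitz
   map lies in a cube of comparable side. *)
Definition cube_null (R : realType) (n : nat) (A : set 'rV[R]_n) : Prop :=
  cover_null (@cube R n) (fun c => `|c.2| ^+ n) A.

Section CubeNull.
Variables (R : realType) (n : nat).
Implicit Types (A B : set 'rV[R]_n).

Let cube_weight_ge0 (c : 'rV[R]_n * R) : 0 <= `|c.2| ^+ n.
Proof. exact: exprn_ge0. Qed.

Lemma cube_null_sub A B : A `<=` B -> cube_null B -> cube_null A.
Proof. exact: cover_null_sub. Qed.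

Lemma cube_null_bigcup (A : nat -> set 'rV[R]_n) :
  (forall k, cube_null (A k)) -> cube_null (\bigcup_k A k).
Proof. exact: cover_null_bigcup. Qed.

Lemma cube_null0 : cube_null (set0 : set 'rV[R]_n).
Proof.
by move=> e e0; exists set0, (fun=> (0, 0)); split=> [x//|];
  rewrite esum_set0 lee_fin ltW.
Qed.

Lemma cube_null_preimage (F : 'rV[R]_n -> 'rV[R]_n) (K : R) A B : 0 < K ->
  (forall u v, A u -> A v -> enorm (u - v) <= K * enorm (F u - F v)) ->
  A `<=` F @^-1` B -> cube_null B -> cube_null A.
Proof.
move=> K0 FK; pose K' := 2 * K * n%:R.
have K'0 : 0 <= K' by rewrite !mulr_ge0// ltW.
apply: (@cover_null_transfer _ _ _ _ _ _ _ _ _ F (1 + K' ^+ n)) => //.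
  by rewrite ltr_pwDl// exprn_ge0.
move=> [c s]; have [[x [Ax Fx]]|nx] := pselect (exists x, A x /\ cube (c, s) (F x)).
(* The centre [c] need not be a value of [F], so the new cube is centred at a point [x] of [A]
   mapped into the old one. The 2 in [K'] comes from comparing two points through the centre, the
   [n] from passing from coordinates to the Euclidean norm. *)
- exists (x, K' * `|s|) => /=; split; last first.
    rewrite normrM normr_id exprMn ger0_norm// ler_wpM2r ?exprn_ge0//.
    by rewrite lerDr.
  move=> y [Ay Fy] i /=; have := coord_le_enorm (y - x) i.
  rewrite !mxE => /le_trans; apply; apply: (le_trans (FK _ _ Ay Ax)).
  have -> : K' * `|s| = K * (n%:R * (2 * `|s|)) by rewrite /K'; ring.
  rewrite ler_pM2l//; apply: enorm_le_coords => j; rewrite !mxE.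
  rewrite (_ : _ - _ = (F y 0 j - c 0 j) - (F x 0 j - c 0 j)); last by ring.
  apply: (le_trans (ler_normB _ _)).
  have h1 := Fy j; have h2 := Fx j; rewrite /= in h1 h2.
  have := ler_norm s; lra.
- exists (0, K' * `|s|) => /=; split.
    by move=> y [Ay Fy]; exfalso; apply: nx; exists y.
  rewrite normrM normr_id exprMn ger0_norm// ler_wpM2r ?exprn_ge0//.
  by rewrite lerDr.
Qed.

Lemma exists_countable_basis : exists B : nat -> set 'rV[R]_n,
  forall (x : 'rV[R]_n) U, nbhs x U -> exists k, B k `<=` U /\ nbhs x (B k).
Proof.
pose Bq (p : 'rV[rat]_n * nat) : set 'rV[R]_n :=
  [set y | forall i, `|y 0 i - ratr (p.1 0 i)| < p.2.+1%:R^-1].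
exists (fun k => if unpickle k is Some p then Bq p else set0).
move=> x U /nbhs_ballP[r /= r0 rU].
have r40 : 0 < r / 4 by rewrite divr_gt0.
have [k hk] : exists k : nat, k.+1%:R^-1 < r / 4.
  have [k _ hk] := near_infty_natSinv_lt (PosNum r40).
  by exists k; exact: hk (leqnn k).
set e : R := k.+1%:R^-1 in hk; have e0 : 0 < e by rewrite invr_gt0.
(* With a rational centre within e/2 of [x] in each coordinate, the cube of half-side [e] contains
   the ball of radius e/2 around [x] and stays within 3e/2 < r/2 of [x]. *)
have /choice[q hq] (i : 'I_n) : exists q : rat, `|x 0 i - ratr q| < e / 2.
  have /rat_in_itvoo[q] : x 0 i - e / 2 < x 0 i + e / 2 by lra.
  by rewrite in_itv/= => ?; exists q; rewrite ltr_norml; lra.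
exists (pickle (\row_i q i, k)); rewrite pickleK; split.
  move=> y By; apply: rU; rewrite -ball_normE /=.
  apply: (@le_lt_trans _ _ (r / 2)); last by lra.
  apply: norm_le_coords => [|i]; first by lra.
  have := By i; have := hq i; rewrite /= !mxE -/e !ltr_norml ler_norml; lra.
apply/nbhs_ballP; exists (e / 2) => /=; first by lra.
move=> y; rewrite -ball_normE /= => xy i; have := hq i; rewrite /= mxE -/e.
have := le_lt_trans (coord_le_norm (x - y) i) xy; rewrite !mxE !ltr_norml; lra.
Qed.

(** Lindelof's argument: countably many basic sets with null trace on [A] cover [A]; the other basic
    sets are replaced by [set0]. *)
Lemma cube_null_local A :
  (forall x, A x -> exists2 U, nbhs x U & cube_null (A `&` U)) -> cube_null A.
Proof.
move=> locA; have [B hB] := exists_countable_basis.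
apply: (@cube_null_sub _
  (\bigcup_k if pselect (cube_null (A `&` B k)) then A `&` B k else set0)).
  move=> x Ax; have [U Ux nU] := locA x Ax; have [k [BU Bx]] := hB x U Ux.
  exists k => //; case: pselect => /= [_|[]].
    by split => //; exact: nbhs_singleton.
  by apply: cube_null_sub nU; exact: setIS.
apply: cube_null_bigcup => k; case: pselect => //= _; exact: cube_null0.
Qed.

End CubeNull.

Section LebesgueNull.
Variables (R : realType).

Let Rmax0 (x : R) : 0 <= Num.max 0 x.
Proof. by rewrite le_max lexx. Qed.

Lemma box_volume_ge0 n (c : 'rV[R]_n * 'rV[R]_n) : 0 <= box_volume c.
Proof. by apply: prodr_ge0 => i _. Qed.

Lemma lebesgue_null_cover n (A : set 'rV[R]_n) :
  lebesgue_null A <-> cover_null (@box R n) (@box_volume R n) A.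
Proof.
split=> [lA e e0|nA].
  have : (lebesgue_outer A < e%:E)%E by rewrite lA lte_fin.
  by move=> /ereal_inf_lt [_ [D [c [Ac ->]]]] /ltW ce; exists D, c.
apply/eqP; rewrite eq_le; apply/andP; split.
  apply/lee_addgt0Pr => e /nA [D [c [Ac ce]]]; rewrite add0e.
  by apply: le_trans ce; apply: ereal_inf_lbound; exists D, c.
apply: le_ereal_inf_tmp => _ [D [c [_ ->]]]; apply: esum_ge0 => k _.
by rewrite lee_fin box_volume_ge0.
Qed.

Lemma lebesgue_nullU n (A B : set 'rV[R]_n) :
  lebesgue_null A -> lebesgue_null B -> lebesgue_null (A `|` B).
Proof.
rewrite !lebesgue_null_cover => nA nB.
apply: (@cover_null_sub _ _ _ _ _ _ (\bigcup_k (if k is 0%N then A else B))).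
  by move=> x [Ax|Bx]; [exists 0%N|exists 1%N].
by apply: cover_null_bigcup => [c|[|k]//]; exact: box_volume_ge0.
Qed.

Definition cube_box n (c : 'rV[R]_n * R) : 'rV[R]_n * 'rV[R]_n :=
  (\row_i (c.1 0 i - c.2), \row_i (c.1 0 i + c.2)).

Lemma cube_sub_box n (c : 'rV[R]_n * R) : cube c `<=` box (cube_box c).
Proof. by move=> x cx i; have := cx i; rewrite /= !mxE ler_norml; lra. Qed.

Lemma cube_box_volume n (c : 'rV[R]_n * R) :
  box_volume (cube_box c) <= 2 ^+ n * `|c.2| ^+ n.
Proof.
have -> : 2 ^+ n * `|c.2| ^+ n = \prod_(i < n) (2 * `|c.2|).
  by rewrite prodr_const card_ord exprMn.
apply: ler_prod => i _.
rewrite Rmax0 /= !mxE ge_max mulr_ge0//=.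
by have := ler_norm c.2; lra.
Qed.

Variables (m1 m2 : nat).

Let row_box (c : 'rV[R]_m1 * 'rV[R]_m1) (c' : 'rV[R]_m2 * 'rV[R]_m2) :=
  (row_mx c.1 c'.1, row_mx c.2 c'.2).

Let sub_row_box c c' (z : 'rV[R]_(m1 + m2)) :
  box c (lsubmx z) -> box c' (rsubmx z) -> box (row_box c c') z.
Proof.
move=> cz cz' i; rewrite -[i]fintype.splitK; case: (fintype.split i) => j /=.
  by have := cz j; rewrite !row_mxEl mxE.
by have := cz' j; rewrite !row_mxEr mxE.
Qed.

Let row_box_volume c c' :
  box_volume (row_box c c') = box_volume c * box_volume c'.
Proof.
rewrite /box_volume big_split_ord /=; congr (_ * _); apply: eq_bigr => i _.
  by rewrite !row_mxEl.
by rewrite !row_mxEr.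
Qed.

Let norm_bounded n (x : 'rV[R]_n) : exists N : nat, cube (0, N%:R) x.
Proof.
have [N hN] : exists N : nat, `|x| <= N%:R.
  by exists (Num.truncn `|x|).+1; rewrite ltW// Num.Theory.truncnS_gt.
exists N => i /=; rewrite mxE subr0; exact: le_trans (coord_le_norm _ _) hN.
Qed.

(** The cylinder over [E] is unbounded, so it is cut into slabs. On a slab, each cube of a cover of
    [E] becomes a box, its volume multiplied by the fixed volume [V] of the bounded factor. *)
Lemma lebesgue_null_lsubmx (E : set 'rV[R]_m1) : cube_null E ->
  lebesgue_null [set z : 'rV[R]_(m1 + m2) | E (lsubmx z)].
Proof.
move=> nE; rewrite lebesgue_null_cover.
pose EN (N : nat) := [set z : 'rV[R]_(m1 + m2) |
  E (lsubmx z) /\ cube (0, N%:R) (rsubmx z)].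
apply: (@cover_null_sub _ _ _ _ _ _ (\bigcup_N EN N)).
  by move=> z Ez; have [N hN] := norm_bounded (rsubmx z); exists N.
apply: cover_null_bigcup => [c|N]; first exact: box_volume_ge0.
pose V := box_volume (cube_box (0 : 'rV[R]_m2, N%:R)).
have V0 : 0 <= V := box_volume_ge0 _.
apply: (@cover_null_transfer _ _ _ _ _ _ _ (fun c => `|c.2| ^+ m1) _ lsubmx
  (1 + 2 ^+ m1 * V) _ _ _ _ _ _ nE) => [|c|c|z []//].
- by rewrite ltr_pwDl// mulr_ge0// exprn_ge0.
- exact: exprn_ge0.
- exists (row_box (cube_box c) (cube_box (0, N%:R))); split.
    by move=> z [[_ Nz] cz]; apply: sub_row_box; exact: cube_sub_box.
  rewrite row_box_volume -/V mulrDl mul1r mulrAC.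
  rewrite (le_trans (ler_wpM2r V0 (cube_box_volume c)))// lerDr exprn_ge0//.
Qed.

Lemma lebesgue_null_rsubmx (E : set 'rV[R]_m2) : cube_null E ->
  lebesgue_null [set z : 'rV[R]_(m1 + m2) | E (rsubmx z)].
Proof.
move=> nE; rewrite lebesgue_null_cover.
pose EN (N : nat) := [set z : 'rV[R]_(m1 + m2) |
  cube (0, N%:R) (lsubmx z) /\ E (rsubmx z)].
apply: (@cover_null_sub _ _ _ _ _ _ (\bigcup_N EN N)).
  by move=> z Ez; have [N hN] := norm_bounded (lsubmx z); exists N.
apply: cover_null_bigcup => [c|N]; first exact: box_volume_ge0.
pose V := box_volume (cube_box (0 : 'rV[R]_m1, N%:R)).
have V0 : 0 <= V := box_volume_ge0 _.
apply: (@cover_null_transfer _ _ _ _ _ _ _ (fun c => `|c.2| ^+ m2) _ rsubmx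
  (1 + V * 2 ^+ m2) _ _ _ _ _ _ nE) => [|c|c|z []//].
- by rewrite ltr_pwDl// mulr_ge0// exprn_ge0.
- exact: exprn_ge0.
- exists (row_box (cube_box (0, N%:R)) (cube_box c)); split.
    by move=> z [[Nz _] cz]; apply: sub_row_box; exact: cube_sub_box.
  rewrite row_box_volume -/V mulrDl mul1r -mulrA.
  rewrite (le_trans (ler_wpM2l V0 (cube_box_volume c)))// lerDr exprn_ge0//.
Qed.

End LebesgueNull.

(** * The invariant cone of a saddle *)

Lemma mulmx_unit_bound (R : realType) (n : nat) (M : 'M[R]_n) : M \in unitmx ->
  exists2 c : R, 0 < c & forall u : 'rV[R]_n, c * enorm u <= enorm (u *m M).
Proof.
move=> uM; have [K K0 HK] := mulmx_enorm_bound (invmx M).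
exists K^-1 => [|u]; first by rewrite invr_gt0.
by rewrite mulrC ler_pdivrMr// mulrC -{1}(mulmxK uM u).
Qed.

(** A nonzero polynomial has fewer roots than its size, so among that many distinct candidates one
    is not a root of the characteristic polynomial. *)
Lemma exists_non_eigenvalue (R : realType) (n : nat) (B : 'M[R]_n) (x y : R) :
  x < y -> exists2 l : R, x < l < y & B - l%:M \in unitmx.
Proof.
(* Denominators start at 2, since 1 would give the excluded endpoint [y]. *)
move=> xy; pose l (k : nat) := x + (y - x) / k.+2%:R.
have ll k : x < l k < y.
  rewrite /l ltrDl divr_gt0 ?subr_gt0//= -ltrBrDl ltr_pdivrMr ?ltr0n//.
  by rewrite ltr_pMr ?subr_gt0// ltr1n.
have l_inj : injective l.
  move=> j k /addrI /mulfI; rewrite subr_eq0 gt_eqF// => /(_ isT) /invr_inj /eqP.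
  by rewrite eqr_nat => /eqP[].
have [/existsP[k nk]|/existsPn all_root] :=
  boolP [exists k : 'I_(size (char_poly B)), ~~ root (char_poly B) (l k)].
  exists (l k) => //; rewrite -row_free_unit -kermx_eq0.
  by move: nk; rewrite -eigenvalue_root_char /eigenvalue negbK.
have := @max_poly_roots _ (char_poly B) [seq l k | k <- iota 0 (size (char_poly B))].
rewrite monic_neq0 ?char_poly_monic// => /(_ isT).
rewrite map_inj_uniq// iota_uniq size_map size_iota ltnn.
have -> : all (root (char_poly B)) [seq l k | k <- iota 0 (size (char_poly B))].
  apply/allP => _ /mapP[k + ->]; rewrite mem_iota add0n => /= kn.
  by have := all_root (Ordinal kn); rewrite negbK.
by move=> /(_ isT isT).
Qed.

Section InvariantCone.
Variables (R : realType) (n : nat) (A : 'M[R]_n) (l : R).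
Hypotheses (A_sym : A^T = A) (l_gt0 : 0 < l).
Implicit Types (D E u v w : 'rV[R]_n).

(** The polarisation of q, needed for the cross terms between a linear part and an error. *)
Definition cone_form u w : R := dot (u *m A) (w *m A) - l * dot u w.

Local Notation B := cone_form.

Lemma cone_formC u w : B u w = B w u.
Proof. by rewrite /B dotC (dotC u). Qed.

Lemma cone_formDl u w D : B (u + w) D = B u D + B w D.
Proof. by rewrite /B mulmxDl !dotDl; ring. Qed.

Lemma cone_formZl t u D : B (t *: u) D = t * B u D.
Proof. by rewrite /B -scalemxAl !dotZl; ring. Qed.

Lemma cone_formDD u w : B (u + w) (u + w) = B u u + 2 * B u w + B w w.
Proof.
rewrite cone_formDl (cone_formC u) (cone_formC w) !cone_formDl (cone_formC w u).
ring.
Qed.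

Lemma cone_form_bound :
  exists2 M : R, 0 < M & forall u w, `|B u w| <= M * (enorm u * enorm w).
Proof.
have [K K0 HK] := mulmx_enorm_bound A; exists (K * K + l).
  by rewrite addr_gt0// mulr_gt0.
move=> u w; rewrite /B; apply: (le_trans (ler_normB _ _)).
rewrite mulrDl; apply: lerD; last first.
  by rewrite normrM gtr0_norm// ler_pM2l// norm_dot_le.
apply: (le_trans (norm_dot_le _ _)); rewrite mulrACA.
by rewrite ler_pM ?enorm_ge0.
Qed.

(* The surplus |D (A^2 - l)|^2 is what absorbs the nonlinear error. *)
Lemma cone_form_mulmx D :
  B (D *m A) (D *m A) = l * B D D + enorm (D *m (A *m A - l%:M)) ^+ 2.
Proof.
rewrite enorm_sqr mulmxBr mul_mx_scalar mulmxA /B.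
rewrite !(dotDl, dotDr, dotNl, dotNr, dotZl, dotZr).
rewrite (dotC D (D *m A *m A)) (dot_mulmx_sym (D *m A) D A_sym); ring.
Qed.

Lemma cone_form_expand : A *m A - l%:M \in unitmx ->
  exists2 e : R, 0 < e & forall D E, enorm (E - D *m A) <= e * enorm D ->
    l * B D D <= B E E.
Proof.
move=> uA; have [c c0 Hc] := mulmx_unit_bound uA.
have [M M0 HM] := cone_form_bound; have [K K0 HK] := mulmx_enorm_bound A.
have S0 : 0 < M * (2 * K + 1) by rewrite mulr_gt0// addr_gt0// mulr_gt0.
(* For E = D A + r, the cross term contributes 2 M K e |D|^2 and the form at r contributes M e^2
   |D|^2, at most M e |D|^2 because e <= 1. Their sum must not exceed the surplus, which is at least
   c^2 |D|^2. *)
pose e := Num.min 1 (c ^+ 2 / (M * (2 * K + 1))).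
have e0 : 0 < e by rewrite lt_min ltr01 divr_gt0// exprn_gt0.
have e1 : e <= 1 by rewrite ge_min lexx.
have ec : M * (2 * K + 1) * e <= c ^+ 2.
  by rewrite mulrC -ler_pdivlMr// ge_min lexx orbT.
exists e => // D E hE; set r := E - D *m A in hE.
have -> : E = D *m A + r by rewrite /r addrCA subrr addr0.
rewrite cone_formDD cone_form_mulmx -!addrA lerDl.
set x := enorm D in hE *; have x0 : 0 <= x := enorm_ge0 D.
have h1 : (c * x) ^+ 2 <= enorm (D *m (A *m A - l%:M)) ^+ 2.
  by rewrite ler_pXn2r ?nnegrE ?mulr_ge0 ?enorm_ge0// ?Hc// ltW.
have ex0 : 0 <= e * x by rewrite mulr_ge0// ltW.
have h2 : `|B (D *m A) r| <= M * (K * x * (e * x)).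
  apply: (le_trans (HM _ _)); rewrite ler_pM2l//.
  by rewrite ler_pM ?enorm_ge0.
have h3 : `|B r r| <= M * (e * x ^+ 2).
  apply: (le_trans (HM _ _)); rewrite ler_pM2l//.
  apply: (@le_trans _ _ (e * x * (e * x))); first by rewrite ler_pM ?enorm_ge0.
  by rewrite mulrACA expr2 ler_wpM2r ?mulr_ge0// ler_piMl// ltW.
have h4 : M * (2 * K + 1) * e * x ^+ 2 <= c ^+ 2 * x ^+ 2.
  by rewrite ler_wpM2r// exprn_ge0.
rewrite !ler_norml in h2 h3; rewrite exprMn in h1; lra.
Qed.

(** Write D = t v + w with w in the hyperplane of zero [i]-th coordinate. Since the form is positive
    at [v], a large t compared with |w| would make it positive at [D]; so |w| controls t and hence
    [D]. *)
Lemma cone_form_graph v (i : 'I_n) : 0 < B v v -> v 0 i != 0 ->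
  exists2 C : R, 0 < C & forall D, B D D <= 0 ->
    enorm D <= C * enorm (D - (D 0 i / v 0 i) *: v).
Proof.
move=> Q0 vi; have [M M0 HM] := cone_form_bound.
set Q := B v v in Q0; pose S := 2 * (M * enorm v) + M.
have v0 := enorm_ge0 v; have Mv0 : 0 <= M * enorm v by rewrite mulr_ge0// ltW.
have S0 : 0 < S by rewrite ltr_wpDl// mulr_ge0.
(* The summand 1 gives |w| <= |t| in the case to be refuted, so that the term quadratic in w is
   bounded by M |w| |t|. *)
pose C1 := S / Q + 1; have C10 : 0 < C1 by rewrite addr_gt0// divr_gt0.
exists (C1 * enorm v + 1); first by rewrite ltr_wpDl// mulr_ge0// ltW.
move=> D; set t := D 0 i / v 0 i; set w := D - t *: v.
have -> : D = t *: v + w by rewrite /w addrCA subrr addr0.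
rewrite cone_formDD !cone_formZl (cone_formC v) cone_formZl -/Q.
set y := enorm w; have y0 : 0 <= y := enorm_ge0 w.
move=> hB; have tC : `|t| <= C1 * y.
  rewrite leNgt; apply/negP => hlt.
  have yt : y <= `|t|.
    apply/ltW; apply: le_lt_trans hlt; rewrite ler_peMl//.
    by rewrite /C1 lerDr divr_ge0// ltW.
  have t0 : 0 < `|t| by apply: le_lt_trans hlt; rewrite mulr_ge0// ltW.
  have h1 : `|B v w| <= M * (enorm v * y) := HM v w.
  have h2 : `|B w w| <= M * (y * y) := HM w w.
  have h3 : `|t| * (`|t| * Q) <= `|t| * (S * y).
    have -> : `|t| * (`|t| * Q) = t * (t * Q).
      by rewrite mulrA -expr2 real_normK ?num_real// expr2 -mulrA.
    have h4 : - (t * B v w) <= `|t| * (M * (enorm v * y)).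
      by rewrite -mulrN (le_trans (ler_norm _))// normrM normrN ler_wpM2l.
    have h5 : M * (y * y) <= M * (y * `|t|).
      by rewrite ler_pM2l// ler_wpM2l.
    rewrite ler_norml in h2; rewrite /S; lra.
  rewrite ler_pM2l// -ler_pdivlMr// in h3.
  have h6 : C1 * y = S * y / Q + y by rewrite /C1; ring.
  lra.
apply: (le_trans (enormD _ _)); rewrite enormZ mulrDl mul1r lerD2r.
by rewrite mulrAC ler_wpM2r.
Qed.

End InvariantCone.

(** The bound l > 1 makes q grow along differences of orbits; l < mu^2 makes q(v) = (mu^2 - l) |v|^2
    positive, hence the graph property; invertibility of A^2 - l makes the surplus definite. *)
Lemma invariant_cone (R : realType) (n : nat) (A : 'M[R]_n) (mu : R)
    (v : 'rV[R]_n) (i : 'I_n) :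
  A^T = A -> v *m A = mu *: v -> 1 < mu -> v 0 i != 0 ->
  exists (q : 'rV[R]_n -> R) (l e M C : R),
    [/\ 1 < l, 0 < e, 0 < C,
      (forall D E : 'rV[R]_n, enorm (E - D *m A) <= e * enorm D ->
         l * q D <= q E) &
      (forall D, q D <= M * enorm D ^+ 2) /\
      (forall D : 'rV[R]_n, q D <= 0 ->
         enorm D <= C * enorm (D - (D 0 i / v 0 i) *: v))].
Proof.
move=> sA vA mu1 vi.
have mu2 : 1 < mu ^+ 2 by rewrite exprn_egt1.
have [l /andP[l1 lmu] uA] := exists_non_eigenvalue (A *m A) mu2.
have l0 : 0 < l by apply: lt_trans l1.
have [e e0 He] := cone_form_expand sA l0 uA.
have [M M0 HM] := cone_form_bound A l0.
have Bv : 0 < cone_form A l v v.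
  rewrite /cone_form vA dotZl dotZr mulrA -expr2 -mulrBl mulr_gt0 ?subr_gt0//.
  rewrite -enorm_sqr exprn_gt0// lt0r enorm_ge0 enorm_eq0 andbT.
  by apply: contraNneq vi => ->; rewrite mxE.
have [C C0 HC] := cone_form_graph l0 Bv vi.
exists (fun D => cone_form A l D D), l, e, M, C; split => //; split => // D.
by rewrite expr2; exact: le_trans (ler_norm _) (HM _ _).
Qed.

(** * Null sets of confined orbits *)

Section GraphNull.
Variables (R : realType) (n : nat) (i : 'I_n) (v : 'rV[R]_n) (C b : R).
Variable W : set 'rV[R]_n.
Hypotheses (vi : v 0 i != 0) (C_gt0 : 0 < C) (b_gt0 : 0 < b).
Hypothesis W_bounded : forall z, W z -> enorm z <= b.

Let proj (z : 'rV[R]_n) : 'rV[R]_n := z - (z 0 i / v 0 i) *: v.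

Let projB z w : proj z - proj w = proj (z - w).
Proof. by apply/rowP => j; rewrite !mxE; ring. Qed.

Hypothesis W_graph : forall z w, W z -> W w ->
  enorm (z - w) <= C * enorm (proj (z - w)).

Let beta := b * (1 + enorm v / `|v 0 i|).

Let beta_gt0 : 0 < beta.
Proof. by rewrite mulr_gt0// ltr_pwDl// divr_ge0// enorm_ge0. Qed.

Let proj_bounded z j : W z -> `|proj z 0 j| <= beta.
Proof.
move=> /W_bounded zb; apply: (le_trans (coord_le_enorm _ _)).
apply: (le_trans (ler_enormB _ _)).
rewrite /beta mulrDr mulr1 lerD// enormZ normrM normfV mulrAC.
rewrite [leRHS]mulrA ler_pM2r ?invr_gt0 ?normr_gt0//.
by rewrite ler_wpM2r ?enorm_ge0//; exact: le_trans (coord_le_enorm _ _) zb.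
Qed.

(** The index of [y] when [-beta, beta] is cut into [N] equal intervals. The right endpoint gets
    index [N], hence [N.+1] values. *)
Let cell (N : nat) (y : R) := Num.truncn ((y + beta) * (N%:R / (2 * beta))).

Let cell_le N y : `|y| <= beta -> (cell N y < N.+1)%N.
Proof.
move=> yb; rewrite ltnS -(@ler_nat R).
have N2 : 0 <= N%:R / (2 * beta) by rewrite divr_ge0// mulr_ge0// ltW.
have h : (y + beta) * (N%:R / (2 * beta)) <= N%:R.
  rewrite [leRHS](_ : _ = (2 * beta) * (N%:R / (2 * beta))); last first.
    by rewrite mulrC divfK// mulf_neq0// gt_eqF.
  by rewrite ler_wpM2r//; move: yb; rewrite ler_norml; lra.
apply: le_trans h; rewrite Num.Theory.truncn_le mulr_ge0//.
by move: yb; rewrite ler_norml; lra.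
Qed.

Let cell_eq N y y' : (0 < N)%N -> `|y| <= beta -> `|y'| <= beta ->
  cell N y = cell N y' -> `|y - y'| <= 2 * beta / N%:R.
Proof.
move=> N0 yb yb' E.
have N2 : 0 < N%:R / (2 * beta) by rewrite divr_gt0 ?ltr0n// mulr_gt0.
have p z : `|z| <= beta -> 0 <= (z + beta) * (N%:R / (2 * beta)).
  by rewrite ler_norml => zb; apply: mulr_ge0; [lra|exact: ltW].
have /andP[h1 h2] := truncn_itv (p y yb); have /andP[h3 h4] := truncn_itv (p y' yb').
rewrite -/(cell N y) in h1 h2; rewrite -/(cell N y') -E in h3 h4.
have -> : 2 * beta / N%:R = (N%:R / (2 * beta))^-1 by rewrite invf_div.
rewrite -[leRHS]mul1r ler_pdivlMr// -[X in _ * X](gtr0_norm N2) -normrM.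
move: h1 h2 h3 h4; rewrite -[(cell N y).+1%:R]natr1.
by rewrite mulrBl ler_norml; set c := N%:R / _; lra.
Qed.

(* Cut the hyperplane into (N+1)^(n-1) cells of side O(1/N): above each cell the
   graph lies in one cube of side O(1/N), so the total volume is O(1/N). *)
Lemma graph_cube_null : cube_null W.
Proof.
rewrite /cube_null; refine (@cover_null_finite R _ _ _ _ _ (0, 0) _ _).
  by move=> c; exact: exprn_ge0.
move=> e e0; pose c0 := 2 * C * n%:R * beta.
have c0_ge0 : 0 <= c0.
  by apply: mulr_ge0; [rewrite !mulr_ge0// ltW|exact: ltW].
(* The total weight is (N+1)^(n-1) (c0/N)^n, at most K0/N because N + 1 <= 2N. *)
pose K0 : R := 2 ^+ n.-1 * c0 ^+ n.
have [N N0 NK] : exists2 N : nat, (0 < N)%N & K0 / N%:R <= e.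
  exists (Num.truncn (K0 / e)).+1 => //; rewrite ler_pdivrMr ?ltr0n//.
  by rewrite mulrC -ler_pdivrMr// ltW// Num.Theory.truncnS_gt.
pose J : finType := {ffun {j : 'I_n | j != i} -> 'I_N.+1}.
pose kappa (z : 'rV[R]_n) : J := [ffun j => inord (cell N (proj z 0 (val j)))].
(* Each cell met by [W] gets a point of [W] above it as the centre of its cube. Cells missed by [W]
   get an arbitrary centre and only add weight. *)
have /choice[rep Hrep] (f : J) : exists w : 'rV[R]_n,
    (exists2 z, W z & kappa z = f) -> W w /\ kappa w = f.
  have [[z Wz kz]|nz] := pselect (exists2 z, W z & kappa z = f).
    by exists z.
  by exists 0 => /nz.
exists J, (fun=> true), (fun f => (rep f, c0 / N%:R)); split.
  move=> x Wx; exists (kappa x) => // j /=.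
  have [Wr kr] := Hrep (kappa x) (ex_intro2 _ _ x Wx erefl).
  set w := rep _ in Wr kr *.
  have := coord_le_enorm (x - w) j; rewrite !mxE => /le_trans; apply.
  apply: (le_trans (W_graph Wx Wr)).
  rewrite (_ : c0 / _ = C * (n%:R * (2 * beta / N%:R))); last by rewrite /c0; ring.
  rewrite ler_pM2l//; apply: enorm_le_coords => k; rewrite -projB !mxE -!/(proj _).
  have [->|ki] := eqVneq k i.
    have h z : z 0 i - z 0 i / v 0 i * v 0 i = 0 by rewrite divfK ?subrr.
    by rewrite !h subrr normr0 divr_ge0// mulr_ge0// ltW.
  have px := proj_bounded k Wx; have pw := proj_bounded k Wr.
  have : cell N (proj w 0 k) = cell N (proj x 0 k).
    move/ffunP: kr => /(_ (exist _ k ki)); rewrite !ffunE /= => /(congr1 val) /=.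
    by rewrite !inordK ?cell_le.
  by move=> /esym/(cell_eq N0 px pw); rewrite !mxE.
rewrite (eq_bigr (fun=> (c0 / N%:R) ^+ n)); last first.
  by move=> f _ /=; rewrite ger0_norm// divr_ge0.
rewrite sumr_const card_ffun card_ord card_sig.
have -> : #|[pred j : 'I_n | j != i]| = n.-1.
  by rewrite (eq_card (_ : _ =i predC1 i))// cardC1 card_ord.
apply: le_trans NK; have n0 : (0 < n)%N by apply: leq_ltn_trans (ltn_ord i).
have N1 : (N.+1 <= 2 * N)%N by rewrite mul2n -addnn -addn1 leq_add2l.
rewrite -[leLHS]mulr_natl natrX.
have NR : (N%:R : R) != 0 by rewrite pnatr_eq0 -lt0n.
have -> : K0 / N%:R = (2 * N%:R) ^+ n.-1 * (c0 / N%:R) ^+ n.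
  rewrite /K0; move: c0 {c0_ge0 K0} (N%:R : R) NR => x y y0; case: n n0 => // k _ /=.
  have yk : y ^+ k != 0 by rewrite expf_neq0.
  rewrite (exprMn _ 2 y) (exprMn _ x y^-1) exprVn [y ^+ k.+1]exprS invfM.
  by field; rewrite y0 yk.
rewrite ler_wpM2r ?exprn_ge0 ?divr_ge0// lerXn2r ?nnegrE ?mulr_ge0//.
by rewrite -natrM ler_nat.
Qed.

End GraphNull.

(** * Symmetry of second derivatives *)

Section Schwarz.
Variables (R : realType) (n : nat).
Implicit Types (f : 'rV[R]_n -> R) (x y v w p : 'rV[R]_n).

(** Applying the mean value theorem to the difference of the two restrictions yields the same
    parameter [t] on both segments. *)
Lemma mvt_difference f x y v :
  (forall t : R, 0 <= t <= 1 -> differentiable f (x + t *: v)) ->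
  (forall t : R, 0 <= t <= 1 -> differentiable f (y + t *: v)) ->
  exists2 t : R, 0 < t < 1 & (f (x + v) - f x) - (f (y + v) - f y) =
    dot v (grad f (x + t *: v)) - dot v (grad f (y + t *: v)).
Proof.
move=> dfx dfy; pose h (s : R) := f (x + s *: v) - f (y + s *: v).
have dh (t : R) : 0 <= t <= 1 -> is_derive t 1 h
    (dot v (grad f (x + t *: v)) - dot v (grad f (y + t *: v))).
  move=> t01; have h1 := is_derive_line (dfx t t01).
  have h2 := is_derive_line (dfy t t01); exact: is_deriveB.
have [t||c c01] := @MVT R h
   (fun t => dot v (grad f (x + t *: v)) - dot v (grad f (y + t *: v))) 0 1 ltr01.
- by rewrite in_itv/= => /andP[t0 t1]; apply: dh; rewrite !ltW.
- apply: derivable_within_continuous => t; rewrite in_itv/= => t01.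
  by case: (dh t t01).
rewrite /h !scale1r !scale0r !addr0 subr0 mulr1 => E; exists c => //.
by rewrite -E !opprB; ring.
Qed.

Lemma dot_delta (i : 'I_n) w : dot (delta_mx 0 i) w = w 0 i.
Proof.
rewrite dotE (bigD1 i)//= big1 ?addr0 ?mxE ?eqxx ?mul1r// => j ji.
by rewrite mxE (negbTE ji) andbF mul0r.
Qed.

Lemma norm_delta_le1 (i : 'I_n) : `|delta_mx 0 i : 'rV[R]_n| <= 1.
Proof.
by apply: norm_le_coords => // j; rewrite mxE; case: (_ && _); rewrite ?normr1 ?normr0.
Qed.

(* The left-hand side is symmetric in i and j, hence Schwarz's theorem. *)
Lemma second_difference f p (i j : 'I_n) (h r : R) : 0 < h -> 2 * h < r ->
  (forall x, `|x - p| < r -> differentiable f x) ->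
  (forall x, `|x - p| < r -> differentiable (partial i f) x) ->
  exists2 y, `|y - p| <= 2 * h &
    f (p + h *: delta_mx 0 j + h *: delta_mx 0 i) - f (p + h *: delta_mx 0 j)
    - (f (p + h *: delta_mx 0 i) - f p) = h ^+ 2 * partial j (partial i f) y.
Proof.
move=> h0 hr df dpf; set u := h *: delta_mx 0 i; set w := h *: delta_mx 0 j.
have close (s t : R) : 0 <= s <= 1 -> 0 <= t <= 1 ->
    `|p + s *: u + t *: w - p| <= 2 * h.
  move=> /andP[s0 s1] /andP[t0 t1].
  have -> : p + s *: u + t *: w - p = s *: u + t *: w
    by rewrite -[p + _ + _]addrA [p + _]addrC addrK.
  apply: (le_trans (ler_normD _ _)).
  have hb (c : R) k : 0 <= c -> c <= 1 -> `|c *: (h *: delta_mx 0 k : 'rV[R]_n)| <= h.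
    move=> c0 c1; rewrite scalerA normrZ ger0_norm; last by rewrite mulr_ge0// ltW.
    apply: (@le_trans _ _ (c * h)); last by rewrite ler_piMl// ltW.
    by rewrite ler_piMr ?norm_delta_le1// mulr_ge0// ltW.
  by rewrite mulrDl mul1r lerD ?hb.
have [||s /andP[s0 s1] ->] := @mvt_difference f (p + w) p u.
- move=> t t01; apply: df; apply: le_lt_trans hr.
  by have := close t 1 t01; rewrite scale1r [p + t *: u + w]addrAC; apply;
    rewrite // lexx ler01.
- move=> t t01; apply: df; apply: le_lt_trans hr.
  by have := close t 0 t01; rewrite scale0r addr0; apply; rewrite // lexx ler01.
have s01 : 0 <= s <= 1 by rewrite !ltW.
have [t t01|t /andP[t0 t1] E] := @mvt_segment _ _ (partial i f) (p + s *: u) w.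
  by apply: dpf; apply: le_lt_trans hr; exact: close.
exists (p + s *: u + t *: w); first by apply: close; rewrite ?s01// !ltW.
move: E; rewrite /u /w !dotZl !dot_delta -/u -/w !mxE.
by rewrite -mulrBr addrAC => ->; rewrite mulrA -expr2.
Qed.

Let subrACA4 (A B C D : R) : A - B - (C - D) = A - C - (B - D).
Proof. by ring. Qed.

Let dist_half_le (A B C e : R) :
  `|A - C| < e / 2 -> `|B - C| < e / 2 -> `|A - B| <= e.
Proof. by rewrite !ltr_norml ler_norml; lra. Qed.

(** One second difference is h^2 times either mixed partial, each evaluated at its own point near
    [p]. Continuity of both at [p] then makes them agree there up to any [e]. *)
Lemma schwarz U f p (i j : 'I_n) : open U -> U p -> Ck_on 2 U f ->
  partial j (partial i f) p = partial i (partial j f) p.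
Proof.
move=> oU Up [df d2f].
have /nbhs_ballP[r /= r0 rU] : nbhs p U by exact: open_nbhs_nbhs.
have inU x : `|x - p| < r -> U x.
  by move=> xp; apply: rU; rewrite -ball_normE /= distrC.
apply/eqP; rewrite -subr_eq0 -normr_le0; apply/ler_addgt0Pr => e e0; rewrite add0r.
have e20 : 0 < e / 2 by rewrite divr_gt0.
have c k l : exists2 s : R, 0 < s & forall x, `|x - p| < s ->
    `|partial l (partial k f) p - partial l (partial k f) x| < e / 2.
  have [_ /(_ l p Up)] := d2f k.
  move=> /(@cvgrPdist_lt _ _ _ (nbhs p)) /(_ _ e20) /nbhs_ballP[s /= s0 sP].
  by exists s => // x xp; apply: sP; rewrite -ball_normE /= distrC.
have [s1 s10 H1] := c i j; have [s2 s20 H2] := c j i.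
pose m := Num.min r (Num.min s1 s2); pose h := m / 4.
have m0 : 0 < m by rewrite !lt_min r0 s10.
have h0 : 0 < h by rewrite divr_gt0.
have hm : 2 * h < m by rewrite /h; lra.
have [hr hs1 hs2] : [/\ 2 * h < r, 2 * h < s1 & 2 * h < s2].
  by move: hm; rewrite !lt_min => /andP[? /andP[]].
have [y yp E1] := second_difference j h0 hr (fun x xp => df x (inU x xp))
  (fun x xp => (d2f i).1 x (inU x xp)).
have [y' yp' E2] := second_difference i h0 hr (fun x xp => df x (inU x xp))
  (fun x xp => (d2f j).1 x (inU x xp)).
have E : partial j (partial i f) y = partial i (partial j f) y'.
  have h2 : h ^+ 2 != 0 by rewrite expf_neq0// gt_eqF.
  apply: (mulfI h2); rewrite [X in f X - _ - _]addrAC in E1.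
  by apply: etrans (esym E1) (etrans (subrACA4 _ _ _ _) E2).
have h1 := H1 y (le_lt_trans yp hs1); have h2 := H2 y' (le_lt_trans yp' hs2).
by rewrite -E in h2; apply: dist_half_le h1 h2.
Qed.

End Schwarz.

(** * Linearisation of the update map at a saddle *)

Section LocalGradient.
Variables (R : realType) (n : nat) (f : 'rV[R]_n -> R) (p : 'rV[R]_n).

Lemma eball_convex (r t : R) (x y : 'rV[R]_n) : eball p r x -> eball p r y ->
  0 <= t <= 1 -> eball p r (x + t *: (y - x)).
Proof.
rewrite /eball /= => xp yp /andP[t0 t1].
have -> : x + t *: (y - x) - p = (1 - t) *: (x - p) + t *: (y - p).
  by apply/rowP => k; rewrite !mxE; ring.
apply: (le_lt_trans (enormD _ _)); rewrite !enormZ !ger0_norm ?subr_ge0//.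
have [->|tn0] := eqVneq t 0; first by rewrite subr0 mul1r mul0r addr0.
have tp : 0 < t by rewrite lt0r tn0.
have h1 : t * enorm (y - p) < t * r by rewrite ltr_pM2l.
have h2 : (1 - t) * enorm (x - p) <= (1 - t) * r.
  by rewrite ler_wpM2l ?subr_ge0// ltW.
lra.
Qed.

Lemma increment_approx (g : 'rV[R]_n -> R) (r e : R) (z w : 'rV[R]_n) :
  (forall x, eball p r x -> differentiable g x /\
     enorm (grad g x - grad g p) < e) ->
  eball p r z -> eball p r w ->
  `|g z - g w - dot (z - w) (grad g p)| <= e * enorm (z - w).
Proof.
move=> gP zr wr.
have [t t01|t /andP[t0 t1]] := @mvt_segment _ _ g w (z - w).
  exact: (gP _ (eball_convex wr zr t01)).1.
have t01 : 0 <= t <= 1 by rewrite !ltW.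
have [_] := gP _ (eball_convex wr zr t01).
have -> : w + (z - w) = z by rewrite addrC subrK.
move: (grad g _) => G hG ->; rewrite -dotNr -dotDr.
apply: (le_trans (norm_dot_le _ _)); rewrite mulrC.
by rewrite ler_wpM2r ?enorm_ge0// ltW.
Qed.

Lemma gradient_approx (e : R) : Ck_near 2 p f -> 0 < e ->
  exists2 r : R, 0 < r & forall z w, eball p r z -> eball p r w ->
    enorm (grad f z - grad f w - (z - w) *m hessian f p) <= e * enorm (z - w).
Proof.
move=> [U [oU Up C2]] e0; have [df d2f] := C2.
have e'0 : 0 < e / n.+1%:R by rewrite divr_gt0.
have : \forall x \near p, U x /\
    forall j : 'I_n, enorm (grad (partial j f) x - grad (partial j f) p) < e / n.+1%:R.
  have h1 : nbhs p U by exact: open_nbhs_nbhs.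
  have h2 : \forall x \near p, forall j : 'I_n,
      enorm (grad (partial j f) x - grad (partial j f) p) < e / n.+1%:R.
    apply: (@filter_forall _ _ _ (nbhs p)) => j.
    have gc : {for p, continuous (grad (partial j f))}.
      apply: row_continuous => i; have [_ /(_ i p Up) h] := d2f j.
      rewrite (_ : (fun x => _) = partial i (partial j f))//.
      by apply/funext => x; rewrite mxE.
    exact: (gc _ (nbhs_eball _ e'0)).
  exact: filterS2 h1 h2.
move=> /nbhs_eballP[r r0 rP]; exists r => // z w zr wr.
(* Row vectors act from the left, so the gradient of the [j]-th partial must be column j of the
   Hessian, while by definition it is row j. *)
have H i j : hessian f p i j = partial i (partial j f) p.
  by rewrite mxE; exact: schwarz C2.
apply: (@le_trans _ _ (n%:R * (e / n.+1%:R * enorm (z - w)))).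
  apply: enorm_le_coords => j.
  have gP x : eball p r x -> differentiable (partial j f) x /\
      enorm (grad (partial j f) x - grad (partial j f) p) < e / n.+1%:R.
    by move=> /rP[Ux /(_ j) hx]; split => //; exact: (d2f j).1.
  have := increment_approx gP zr wr.
  have -> : dot (z - w) (grad (partial j f) p) = ((z - w) *m hessian f p) 0 j.
    rewrite dotE [RHS]mxE; apply: eq_bigr => i _.
    by rewrite H [grad _ _ _ _]mxE.
  have gE x : grad f x 0 j = partial j f x by rewrite mxE.
  by rewrite -!gE [X in _ -> `|X| <= _]mxE [X in _ -> `|X + _| <= _]mxE
    [X in _ -> `|_ + X + _| <= _]mxE [X in _ -> `|_ + X| <= _]mxE.
have n1 : n%:R / n.+1%:R <= 1 :> R by rewrite ler_pdivrMr ?ltr0n// mul1r ler_nat.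
rewrite mulrA ler_wpM2r ?enorm_ge0// mulrCA.
by rewrite ler_piMr// ltW.
Qed.

Lemma saddle_confined_null (d : R) : gen_saddle f p -> 0 < d ->
  exists2 U : set 'rV[R]_n, nbhs p U &
    cube_null [set x | forall k, U (iter k (fun x => x - d *: grad f x) x)].
Proof.
move=> [cp C2 [a [a0 /eigenvalueP[v vH v0]]]] d0.
pose H := hessian f p; pose A := 1%:M - d *: H.
have H_sym : H^T = H.
  have [V [oV Vp C2V]] := C2.
  by apply/matrixP => i j; rewrite !mxE; exact: schwarz C2V.
have A_sym : A^T = A by rewrite /A linearB linearZ /= H_sym trmx1.
have vA : v *m A = (1 - d * a) *: v.
  by rewrite mulmxBr mulmx1 -scalemxAr vH scalerA scalerBl scale1r.
have mu1 : 1 < 1 - d * a by rewrite ltrDl oppr_gt0 pmulr_rlt0.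
have [i vi] : exists i, v 0 i != 0 by exact/rV0Pn.
have [q [l [e [M [C [l1 e0 C0 q_exp [q_le q_graph]]]]]]] :=
  invariant_cone A_sym vA mu1 vi.
(* The update map multiplies the error of the gradient by [d]. *)
have ed0 : 0 < e / d by rewrite divr_gt0.
have [r r0 approx] := gradient_approx C2 ed0.
exists (eball p r); first exact: nbhs_eball.
pose F x := x - d *: grad f x; set W := [set x | _].
have F_exp z w : eball p r z -> eball p r w -> l * q (z - w) <= q (F z - F w).
  move=> zr wr; apply: q_exp.
  have -> : F z - F w - (z - w) *m A =
      - d *: (grad f z - grad f w - (z - w) *m H).
    rewrite /A mulmxBr mulmx1 -scalemxAr /F scaleNr !scalerBr.
    by apply/rowP => k; rewrite !mxE; ring.
  rewrite enormZ normrN gtr0_norm//.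
  have h := approx z w zr wr; rewrite -(ler_pM2l d0) in h.
  by apply: le_trans h _; rewrite mulrA (mulrC d) divfK ?gt_eqF.
have W_cone z w : W z -> W w -> q (z - w) <= 0.
  move=> Wz Ww; rewrite leNgt; apply/negP => qpos.
  have grow k : l ^+ k * q (z - w) <= q (iter k F z - iter k F w).
    elim: k => [|k IH]; first by rewrite mul1r.
    rewrite exprS -mulrA; apply: le_trans (F_exp _ _ (Wz k) (Ww k)).
    by rewrite ler_pM2l// (lt_trans ltr01).
  have B0 : 0 < `|M| * (2 * r) ^+ 2 + 1 by rewrite ltr_wpDl// mulr_ge0//
    exprn_ge0// mulr_ge0// ltW.
  have il : 0 < l^-1 < 1.
    by rewrite invr_gt0 invf_lt1 ?l1 ?andbT (lt_trans ltr01).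
  (* With ratio 1/l this gives l^k q(z - w) above the bound |M| (2r)^2 + 1. But two points of the
     ball differ by less than 2r, which bounds q; [M] appears in absolute value because its sign is
     not recorded. *)
  have [k] := geometric_small B0 il qpos.
  rewrite exprVn mulrC ltr_pdivrMr ?exprn_gt0 ?(lt_trans ltr01)//.
  rewrite [_ * l ^+ k]mulrC ltNge => /negP; apply; apply: (le_trans (grow k)).
  apply: (le_trans (q_le _)).
  apply: (@le_trans _ _ (`|M| * (2 * r) ^+ 2)); last by rewrite lerDl.
  apply: (@le_trans _ _ (`|M| * enorm (iter k F z - iter k F w) ^+ 2)).
    by rewrite ler_wpM2r ?exprn_ge0 ?enorm_ge0// ler_norm.
  rewrite ler_wpM2l// lerXn2r ?nnegrE ?enorm_ge0 ?mulr_ge0 ?(ltW r0)//.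
  rewrite (_ : _ - _ = (iter k F z - p) - (iter k F w - p)); last first.
    by rewrite opprB addrA subrK.
  apply: (le_trans (ler_enormB _ _)).
  have := Wz k; have := Ww k; rewrite /eball /= -/F; lra.
have b0 : 0 < enorm p + r by rewrite ltr_wpDl// enorm_ge0.
apply: (graph_cube_null vi C0 b0) => [z /(_ 0%N)|z w Wz Ww].
  rewrite /eball /= => zp; rewrite -[z](subrK p) (le_trans (enormD _ _))//.
  by rewrite addrC lerD2l ltW.
exact/q_graph/W_cone.
Qed.

End LocalGradient.

(** * Starting points that converge to a saddle *)

Section GradientDescent.
Variables (R : realType) (n : nat) (f : 'rV[R]_n -> R) (r L : 'rV[R]_n -> R).
Variables (d0 a b : R).
Hypothesis f_C1 : Ck_on 1 setT f.
Hypotheses (r_cont : continuous r) (L_cont : continuous L).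
Hypotheses (r_gt0 : forall x, 0 < r x) (L_gt0 : forall x, 0 < L x).
Hypothesis f_lip : forall x, elipschitz_on (eball x (r x)) (L x) (grad f).
Hypotheses (d0_gt0 : 0 < d0) (a01 : 0 < a < 1) (b01 : 0 < b < 1).

Let F := gd_update f r L d0 a b.
Let sz := stepsize f r L d0 a b.

(** The identity minus a map of Lipschitz constant below a < 1 shrinks distances at most by the
    factor 1 - a. *)
Lemma gradient_step_expand (d : R) (p u v : 'rV[R]_n) : 0 <= d -> d * L p < a ->
  eball p (r p) u -> eball p (r p) v ->
  (1 - a) * enorm (u - v) <= enorm ((u - d *: grad f u) - (v - d *: grad f v)).
Proof.
move=> dge dL pu pv.
have -> : u - d *: grad f u - (v - d *: grad f v) =
    (u - v) - d *: (grad f u - grad f v).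
  by apply/rowP => i; rewrite !mxE; ring.
have h1 := lerB_enormD (u - v) (- (d *: (grad f u - grad f v))).
apply: le_trans h1; rewrite enormN enormZ ger0_norm//.
have h2 : d * enorm (grad f u - grad f v) <= d * (L p * enorm (u - v)).
  by rewrite ler_wpM2l// f_lip.
have h3 : d * L p * enorm (u - v) <= a * enorm (u - v).
  by rewrite ler_wpM2r ?enorm_ge0// ltW.
rewrite mulrBl mul1r; lra.
Qed.

(** On each of the countably many level sets of the step size, the update is a gradient step of
    fixed length, inverse-Lipschitz near every point of that level set. *)
Lemma gd_update_preimage_null B : cube_null B -> cube_null (F @^-1` B).
Proof.
move=> nB; pose X k := [set x | sz x = b ^+ k * d0] `&` F @^-1` B.
apply: (@cube_null_sub _ _ _ (\bigcup_k X k)).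
  move=> x Bx; have [k [kx _ _]] := stepsizeP f r_gt0 L_gt0 d0_gt0 a01 b01 x.
  by exists k.
apply: cube_null_bigcup => k; apply: cube_null_local => x [xk _].
exists (eball x (r x)); first exact: nbhs_eball.
have a1 : 0 < 1 - a by rewrite subr_gt0; case/andP: a01.
apply: (@cube_null_preimage _ _ F (1 - a)^-1 _ B) => //.
- by rewrite invr_gt0.
- move=> u v [[uk _] ux] [[vk _] vx]; rewrite mulrC ler_pdivlMr// mulrC.
  rewrite /F /gd_update -!/(sz _) uk vk; apply: gradient_step_expand ux vx.
  + by rewrite mulr_ge0 ?ltW// exprn_gt0//; case/andP: b01.
  + by rewrite -xk; exact: stepsize_lt_L.
- by move=> u [[_ Fu] _].
Qed.

(** An orbit converging to such a saddle eventually stays in a basic set [B k] where the step is b^j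
    d0, and from then on it is an orbit of the fixed map [G j] confined to [B k]. The pairs (k, j)
    and the entry times N are countable, whatever the number of saddles. *)
Lemma gd_avoids_nonresonant_saddles : exists E : set 'rV[R]_n, cube_null E /\
  forall x0, ~ E x0 -> forall p, iter k F x0 @[k --> \oo] --> p ->
    gen_saddle f p -> (forall k : nat, a / L p <> b ^+ k * d0) -> False.
Proof.
have [B hB] := exists_countable_basis R n.
pose G (j : nat) (x : 'rV[R]_n) := x - (b ^+ j * d0) *: grad f x.
pose W k j := [set x | forall m, B k (iter m (G j) x)].
(* A confined set is known to be null only when its pair (k, j) comes from a saddle; the others are
   discarded so that the union is null. *)
pose W' k j := if pselect (cube_null (W k j)) then W k j else set0.
have nW' : cube_null (\bigcup_k \bigcup_j W' k j).
  apply: cube_null_bigcup => k; apply: cube_null_bigcup => j.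
  by rewrite /W'; case: pselect => [?|?] //=; exact: cube_null0.
exists (\bigcup_N [set x | (\bigcup_k \bigcup_j W' k j) (iter N F x)]); split.
  apply: cube_null_bigcup; elim=> [|N IH]; first exact: nW'.
  apply: cube_null_sub (gd_update_preimage_null IH) => x /=.
  by rewrite -iterSr.
move=> x0 nE p cvp sp nr; apply: nE; have [cp _ _] := sp.
have gc := C1_grad_continuous f_C1.
have [d [d_gt0 _ nd]] := stepsize_locally_constant r_gt0 L_gt0 d0_gt0 a01 b01
  r_cont L_cont gc cp nr.
have [U Up nU] := saddle_confined_null sp d_gt0.
have [k [BU Bp]] := hB p _ (filterI Up nd).
have [j [dj _ _]] := stepsizeP f r_gt0 L_gt0 d0_gt0 a01 b01 p.
have {}dj : d = b ^+ j * d0 by rewrite -dj; exact/esym/(nbhs_singleton nd).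
have [N _ HN] := cvp _ Bp.
exists N => //; exists k => //; exists j => //; rewrite /W'.
have WU : W k j `<=` [set x | forall m, U (iter m (fun x => x - d *: grad f x) x)].
  by move=> x Wx m; have [+ _] := BU _ (Wx m); rewrite /G -dj.
case: pselect => [nW|[]] /=; last exact: cube_null_sub nU.
move=> m; have E : iter m (G j) (iter N F x0) = iter (m + N) F x0.
  elim: m => // m IH; rewrite iterS IH addSn iterS /F /gd_update /G -!/F.
  have [_ ->] := BU _ (HN (m + N)%N (leq_addl _ _)).
  by rewrite dj.
by rewrite E; exact: HN (leq_addl _ _).
Qed.

End GradientDescent.

(** * Cluster points *)

(** Cluster points through neighbourhoods: this form passes to coordinates by continuity and comes
    out of compactness without extracting a subsequence. *)
Definition frequents (R : realType) (n : nat) (u : nat -> 'rV[R]_n)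
    (p : 'rV[R]_n) : Prop :=
  forall U, nbhs p U -> forall N, exists2 k, (N <= k)%N & U (u k).

Section Frequents.
Variables (R : realType) (n : nat) (u : nat -> 'rV[R]_n).
Implicit Types p q : 'rV[R]_n.

Lemma cluster_frequents p : cluster_point u p -> frequents u p.
Proof.
move=> [phi [phi_incr cv]] U Up N.
have phi_ge k : (k <= phi k)%N.
  by elim: k => // k IH; exact: leq_ltn_trans (phi_incr _ _ (ltnSn k)).
have [M _ HM] := cv _ Up; exists (phi (maxn M N)).
  exact: leq_trans (leq_maxr _ _) (phi_ge _).
by apply: HM; exact: leq_maxl.
Qed.

(** Bolzano-Weierstrass along the indices satisfying [P], which later singles out the times at which
    the sequence leaves a ball. *)
Lemma exists_frequents (M : R) (P : nat -> Prop) :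
  (forall N, exists2 k, (N <= k)%N & P k /\ enorm (u k) <= M) ->
  exists p, forall U, nbhs p U -> forall N, exists k, [/\ (N <= k)%N, P k & U (u k)].
Proof.
move=> H; have /choice[phi Hphi] N : exists k, [/\ (N <= k)%N, P k & enorm (u k) <= M].
  by have [k ? []] := H N; exists k.
pose A := [set x : 'rV[R]_n | forall i, `[(- M), M]%classic (x ord0 i)].
have cA : compact A.
  apply: (@rV_compact R n (fun=> `[(- M), M]%classic)) => i.
  exact: segment_compact.
have FA : (u \o phi @ \oo) A.
  exists 0%N => // N _ i /=; rewrite in_itv /= -ler_norml.
  by have [_ _ ub] := Hphi N; exact: le_trans (coord_le_enorm _ _) ub.
have [p [_ cp]] := cA _ _ FA; exists p => U Up N.
have FN : (u \o phi @ \oo) [set u (phi k) | k in [set k | (N <= k)%N]].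
  by exists N => // k /= Nk; exists k.
have [_ [[k Nk <-] Uk]] := cp _ _ FN Up.
by have [kp Pk _] := Hphi k; exists (phi k); split => //; exact: leq_trans kp.
Qed.

Lemma frequents_or_diverges :
  (exists p, frequents u p) \/ enorm (u k) @[k --> \oo] --> +oo.
Proof.
have [[M HM]|nM] := pselect (exists M : R,
    forall N, exists2 k, (N <= k)%N & enorm (u k) <= M).
  left; have [|p Hp] := @exists_frequents M (fun=> True).
    by move=> N; have [k] := HM N; exists k.
  by exists p => U /Hp Up N; have [k [? _ ?]] := Up N; exists k.
right; apply/cvgryPge => M; apply: contrapT => nN; apply: nM; exists M => N.
apply: contrapT => nk; apply: nN; exists N => // k /= Nk.
by rewrite leNgt; apply/negP => /ltW kM; apply: nk; exists k.
Qed.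

Lemma not_cvg_far p : ~ u k @[k --> \oo] --> p ->
  exists2 e : R, 0 < e & forall N, exists2 k, (N <= k)%N & e <= enorm (u k - p).
Proof.
move=> ncv; apply: contrapT => ne; apply: ncv; move=> U /nbhs_eballP[e e0 eU].
apply: contrapT => nU; apply: ne; exists e => // N.
apply: contrapT => nk; apply: nU; exists N => // k /= Nk; apply: eU.
by rewrite /eball /= ltNge; apply/negP => ek; apply: nk; exists k.
Qed.

Lemma exists_crossing (P : pred nat) (j k : nat) : (j <= k)%N -> P j -> ~~ P k ->
  exists m, [/\ (j <= m)%N, P m & ~~ P m.+1].
Proof.
elim: k => [|k IH]; first by rewrite leqn0 => /eqP-> ->.
rewrite leq_eqVlt => /orP[/eqP-> ->//|]; rewrite ltnS => jk Pj nPk.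
by case: (boolP (P k)) => [Pk|]; [exists k|exact: IH].
Qed.

(* With vanishing steps the sequence cannot jump over the sphere of radius d. *)
Lemma frequents_on_spheres p : frequents u p ->
  enorm (u k.+1 - u k) @[k --> \oo] --> (0 : R) -> ~ u k @[k --> \oo] --> p ->
  exists2 e : R, 0 < e & forall d : R, 0 < d < e ->
    exists2 q, frequents u q & enorm (q - p) = d.
Proof.
move=> up step /not_cvg_far[e e0 far]; exists e => // d /andP[d0 de].
pose P k := (enorm (u k - p) <= d) && (d < enorm (u k.+1 - p)).
have cross N : exists2 k, (N <= k)%N & P k.
  have [j Nj uj] := up _ (nbhs_eball p d0) N; have [k jk uk] := far j.
  have [||m [jm m1 m2]] := @exists_crossing (fun k => enorm (u k - p) <= d) j k jk.
  - by rewrite ltW.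
  - by rewrite -ltNge (lt_le_trans de).
  by exists m; [exact: leq_trans jm|rewrite /P m1 ltNge].
have [|q Hq] := @exists_frequents (d + enorm p) P.
  move=> N; have [k Nk Pk] := cross N; exists k => //; split => //.
  rewrite -[u k](subrK p) (le_trans (enormD _ _))// lerD2r.
  by case/andP: Pk.
exists q; first by move=> U /Hq Uq N; have [k [? _ ?]] := Uq N; exists k.
apply/eqP; rewrite -subr_eq0 -normr_le0; apply/ler_addgt0Pr => h h0; rewrite add0r.
have h20 : 0 < h / 2 by rewrite divr_gt0.
have /cvgrPdist_lt/(_ _ h20)[N _ HN] := step.
have [k [Nk /andP[Pk Pk'] kq]] := Hq _ (nbhs_eball q h20) N.
have := HN k Nk; rewrite sub0r normrN ger0_norm ?enorm_ge0// => sk.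
have h1 : enorm (u k.+1 - p) <= enorm (u k.+1 - u k) + enorm (u k - p).
  by rewrite -[u k.+1 - p](subrKA (u k)) enormD.
have h2 : enorm (u k - p) <= enorm (u k - q) + enorm (q - p).
  by rewrite -[u k - p](subrKA q) enormD.
have h3 : enorm (q - p) <= enorm (q - u k) + enorm (u k - p).
  by rewrite -[q - p](subrKA (u k)) enormD.
rewrite (enormBC q (u k)) in h3; rewrite /eball /= in kq.
move: (enorm (q - p)) (enorm (u k - q)) (enorm (u k - p)) (enorm (u k.+1 - p))
  (enorm (u k.+1 - u k)) h1 h2 h3 kq sk Pk Pk' => A B C D E.
by rewrite ler_norml; lra.
Qed.

End Frequents.

(** Otherwise the distances from [p] to [A], a countable set, would fill an interval of positive
    measure. *)
Lemma enorm_spheres_uncountable (R : realType) (n : nat) (A : set 'rV[R]_n)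
    (p : 'rV[R]_n) (e : R) : countable A -> 0 < e ->
  exists2 d : R, 0 < d < e & forall q, A q -> enorm (q - p) <> d.
Proof.
move=> cA e0; apply: contrapT => H.
have sub : [set` `]0, e[] `<=` (fun q => enorm (q - p)) @` A.
  move=> d /=; rewrite in_itv /= => de; apply: contrapT => nd; apply: H.
  by exists d => // q Aq qd; apply: nd; exists q.
have c1 : countable [set` `]0, e[ : interval R].
  apply: sub_countable (subset_card_le sub) _.
  exact: sub_countable (card_image_le _ _) cA.
have := countable_lebesgue_measure0 c1.
by rewrite lebesgue_measure_itv /= lte_fin e0 oppr0 adde0 => -[/eqP]; rewrite gt_eqF.
Qed.

(** * Separable functions *)

Section AffinePullback.
Variables (R : realType) (m N : nat) (M : 'M[R]_(m, N)) (s : 'I_m -> 'I_N).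
Hypothesis M_delta : forall i, delta_mx 0 i *m M = delta_mx 0 (s i) :> 'rV[R]_N.

(* An equality of difference quotients, so no differentiability is needed. *)
Lemma partial_affine (f : 'rV[R]_N -> R) (g : 'rV[R]_m -> R) (c : 'rV[R]_N) (k : R) :
  (forall x, g x = f (x *m M + c) + k) ->
  forall i x, partial i g x = partial (s i) f (x *m M + c).
Proof.
move=> gE i x; rewrite /partial /derive.
suff -> : (fun h => h^-1 *: (g (h *: delta_mx 0 i + x) - g x)) =
   (fun h => h^-1 *: (f (h *: delta_mx 0 (s i) + (x *m M + c)) - f (x *m M + c))).
  by [].
apply/funext => h; rewrite !gE.
have -> : (h *: delta_mx 0 i + x) *m M + c = h *: delta_mx 0 (s i) + (x *m M + c).
  by rewrite mulmxDl -scalemxAl M_delta addrA.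
by congr (_ *: _); rewrite opprD addrACA subrr addr0.
Qed.

Lemma Ck_on_affine (k : nat) (U : set 'rV[R]_N) (f : 'rV[R]_N -> R)
    (g : 'rV[R]_m -> R) (c : 'rV[R]_N) (t : R) :
  (forall x, g x = f (x *m M + c) + t) -> Ck_on k U f ->
  Ck_on k ((fun x => x *m M + c) @^-1` U) g.
Proof.
have aff_cont : continuous (fun x : 'rV[R]_m => x *m M + c).
  move=> x; apply: (@continuousD _ _ _ (fun x : 'rV[R]_m => x *m M) (fun=> c)).
    exact: mulmx_continuous.
  exact: cst_continuous.
have aff_diff x : differentiable (fun x : 'rV[R]_m => x *m M + c) x.
  apply: (@differentiableD _ _ _ (fun x : 'rV[R]_m => x *m M) (fun=> c)).
    pose F : {linear 'rV[R]_m -> 'rV[R]_N} := mulmxr M.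
    have h : differentiable F x by apply: linear_differentiable;
      exact: mulmx_continuous.
    exact: h.
  exact: differentiable_cst.
(* The induction passes to the partials of [f] and [g], for which the additive constant is 0. *)
elim: k f g t => [|k IH] f g t gE.
  move=> /= cf x Ux; rewrite (_ : g = (fun y => f (y *m M + c)) \+ (fun=> t));
    last exact/funext.
  apply: continuousD; last exact: cst_continuous.
  by apply: continuous_comp; [exact: aff_cont|exact: cf].
move=> /= [df cf]; split.
  move=> x Ux; rewrite (_ : g = (fun y => f (y *m M + c)) \+ (fun=> t));
    last exact/funext.
  apply: differentiableD; last exact: differentiable_cst.
  by apply: (differentiable_comp (aff_diff x)); exact: df.
move=> i; apply: (IH (partial (s i) f) _ 0); last exact: cf.
by move=> x; rewrite addr0; exact: partial_affine gE i x.
Qed.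

Lemma Ck_near_affine (k : nat) (f : 'rV[R]_N -> R) (g : 'rV[R]_m -> R)
    (c : 'rV[R]_N) (t : R) (x : 'rV[R]_m) :
  (forall x, g x = f (x *m M + c) + t) -> Ck_near k (x *m M + c) f ->
  Ck_near k x g.
Proof.
move=> gE [U [oU Ux CU]]; exists ((fun x => x *m M + c) @^-1` U); split => //.
  apply: open_comp oU => y _.
  apply: (@continuousD _ _ _ (fun x : 'rV[R]_m => x *m M) (fun=> c)).
    exact: mulmx_continuous.
  exact: cst_continuous.
exact: Ck_on_affine gE CU.
Qed.

End AffinePullback.

Section Split.
Variables (R : realType) (m1 m2 : nat).
Implicit Types (f : 'rV[R]_(m1 + m2) -> R) (x : 'rV[R]_m1) (y : 'rV[R]_m2).

(** With the next one, the matrices of the two coordinate inclusions: the slices of f through a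
    point are affine pullbacks, and f1 and f2 are such slices up to a constant. *)
Let Ml : 'M[R]_(m1, m1 + m2) := row_mx 1%:M 0.
Let Mr : 'M[R]_(m2, m1 + m2) := row_mx 0 1%:M.

Let Ml_delta i : delta_mx 0 i *m Ml = delta_mx 0 (lshift m2 i) :> 'rV[R]_(m1 + m2).
Proof.
rewrite mul_mx_row mulmx1 mulmx0; apply/rowP => j; rewrite !mxE.
rewrite -[j in RHS]fintype.splitK; case: (fintype.split j) => k /=.
  by rewrite mxE (inj_eq (@lshift_inj _ _)).
by rewrite mxE eq_rlshift.
Qed.

Let Mr_delta i : delta_mx 0 i *m Mr = delta_mx 0 (rshift m1 i) :> 'rV[R]_(m1 + m2).
Proof.
rewrite mul_mx_row mulmx1 mulmx0; apply/rowP => j; rewrite !mxE.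
rewrite -[j in RHS]fintype.splitK; case: (fintype.split j) => k /=.
  by rewrite mxE eq_lrshift.
by rewrite mxE (inj_eq (@rshift_inj _ _)).
Qed.

Let MlE x y : x *m Ml + row_mx 0 y = row_mx x y.
Proof. by rewrite mul_mx_row mulmx1 mulmx0 add_row_mx addr0 add0r. Qed.

Let MrE x y : y *m Mr + row_mx x 0 = row_mx x y.
Proof. by rewrite mul_mx_row mulmx1 mulmx0 add_row_mx addr0 add0r. Qed.

Section SplitLemmas.
Variables (f : 'rV[R]_(m1 + m2) -> R) (f1 : 'rV[R]_m1 -> R) (f2 : 'rV[R]_m2 -> R).
Hypothesis f_split : forall x y, f (row_mx x y) = f1 x + f2 y.

Let f1E y x : f1 x = f (x *m Ml + row_mx 0 y) + - f2 y.
Proof. by rewrite MlE f_split addrK. Qed.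

Let f2E x y : f2 y = f (y *m Mr + row_mx x 0) + - f1 x.
Proof. by rewrite MrE f_split addrAC subrr add0r. Qed.

Lemma partial_split_l i x y : partial (lshift m2 i) f (row_mx x y) = partial i f1 x.
Proof. by rewrite (partial_affine Ml_delta (f1E y)) MlE. Qed.

Lemma partial_split_r i x y : partial (rshift m1 i) f (row_mx x y) = partial i f2 y.
Proof. by rewrite (partial_affine Mr_delta (f2E x)) MrE. Qed.

Lemma grad_split x y : grad f (row_mx x y) = row_mx (grad f1 x) (grad f2 y).
Proof.
apply/rowP => i; rewrite -[i]fintype.splitK; case: (fintype.split i) => j /=.
  by rewrite row_mxEl !mxE partial_split_l.
by rewrite row_mxEr !mxE partial_split_r.
Qed.

Lemma critical_split x y :
  critical f (row_mx x y) <-> critical f1 x /\ critical f2 y.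
Proof.
rewrite /critical grad_split -[X in _ = X]hsubmxK; split.
  by move=> /eq_row_mx[-> ->]; rewrite !linear0.
by move=> [-> ->]; rewrite !linear0.
Qed.

Lemma C1_split_l : Ck_on 1 setT f -> Ck_on 1 setT f1.
Proof.
by move=> /(Ck_on_affine Ml_delta (f1E 0)); rewrite preimage_setT.
Qed.

Lemma C1_split_r : Ck_on 1 setT f -> Ck_on 1 setT f2.
Proof.
by move=> /(Ck_on_affine Mr_delta (f2E 0)); rewrite preimage_setT.
Qed.

End SplitLemmas.

Lemma hessian_split f (f1 : 'rV[R]_m1 -> R) (f2 : 'rV[R]_m2 -> R) :
    (forall x y, f (row_mx x y) = f1 x + f2 y) ->
  forall x y, hessian f (row_mx x y) =
    block_mx (hessian f1 x) 0 0 (hessian f2 y).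
Proof.
move=> fE x y.
(* A first partial of f is itself separable with one zero summand, so the splitting of partials
   applies to it again. *)
have gl i x' y' : partial (lshift m2 i) f (row_mx x' y') =
    partial i f1 x' + (fun=> 0) y'.
  by rewrite addr0; exact: partial_split_l.
have gr i x' y' : partial (rshift m1 i) f (row_mx x' y') =
    (fun=> 0) x' + partial i f2 y'.
  by rewrite add0r; exact: partial_split_r.
apply/matrixP => i j.
rewrite -[i]fintype.splitK -[j]fintype.splitK mxE.
case: (fintype.split i) => i' /=; case: (fintype.split j) => j' /=.
- by rewrite block_mxEul mxE (partial_split_l (gl i')).
- by rewrite block_mxEur mxE (partial_split_r (gl i')) /partial (derive_cst 0).
- by rewrite block_mxEdl mxE (partial_split_l (gr i')) /partial (derive_cst 0).
- by rewrite block_mxEdr mxE (partial_split_r (gr i')).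
Qed.

(** An eigenvector of the block-diagonal Hessian has a nonzero component, which is an eigenvector of
    the corresponding block for the same negative eigenvalue. *)
Lemma gen_saddle_split f (f1 : 'rV[R]_m1 -> R) (f2 : 'rV[R]_m2 -> R) :
    (forall x y, f (row_mx x y) = f1 x + f2 y) ->
  forall x y, gen_saddle f (row_mx x y) -> gen_saddle f1 x \/ gen_saddle f2 y.
Proof.
move=> fE x y [/(critical_split fE)[c1 c2] C2 [a [a0 /eigenvalueP[v vH v0]]]].
have C1 : Ck_near 2 x f1.
  apply: (Ck_near_affine Ml_delta (c := row_mx 0 y) (t := - f2 y) (f := f)).
    by move=> x'; rewrite MlE fE addrK.
  by rewrite MlE.
have C2' : Ck_near 2 y f2.
  apply: (Ck_near_affine Mr_delta (c := row_mx x 0) (t := - f1 x) (f := f)).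
    by move=> y'; rewrite MrE fE addrAC subrr add0r.
  by rewrite MrE.
move: vH v0; rewrite -[v]hsubmxK (hessian_split fE) mul_row_block !mulmx0 addr0 add0r.
rewrite scale_row_mx => /eq_row_mx[v1 v2] v0.
have [l0|l0] := eqVneq (lsubmx v) 0; [right|left]; split => //; exists a; split => //.
  apply/eigenvalueP; exists (rsubmx v) => //.
  by apply: contraNneq v0 => r0; rewrite l0 r0 row_mx0.
by apply/eigenvalueP; exists (lsubmx v).
Qed.

Lemma enorm_row_mx (x : 'rV[R]_m1) (y : 'rV[R]_m2) :
  enorm (row_mx x y) ^+ 2 = enorm x ^+ 2 + enorm y ^+ 2.
Proof.
rewrite !enorm_sqr !dotE big_split_ord /=; congr (_ + _); apply: eq_bigr => i _.
  by rewrite row_mxEl.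
by rewrite row_mxEr.
Qed.

Lemma lsubmx_continuous : continuous (@lsubmx R 1 m1 m2).
Proof.
move=> p; apply/(@cvgrPdist_lt _ _ _ (nbhs p)) => e e0.
apply/nbhs_ballP; exists e => //= x; rewrite -ball_normE /=; apply: le_lt_trans.
apply: norm_le_coords => // i; rewrite -linearB mxE; exact: coord_le_norm.
Qed.

Lemma rsubmx_continuous : continuous (@rsubmx R 1 m1 m2).
Proof.
move=> p; apply/(@cvgrPdist_lt _ _ _ (nbhs p)) => e e0.
apply/nbhs_ballP; exists e => //= x; rewrite -ball_normE /=; apply: le_lt_trans.
apply: norm_le_coords => // i; rewrite -linearB mxE; exact: coord_le_norm.
Qed.

End Split.

(** * Almost every parameter *)

Section AlmostEveryParameter.
Variable R : realType.

Local Notation lambda := (@lebesgue_measure R).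

(** For p = (d0, a, b) and [c] a value of L, the equation says that a / L lies on the step grid. *)
Let resonance (c : R) (n : nat) : set (R * R * R) :=
  [set p | [/\ p.1.2 = c * (p.2 ^+ n * p.1.1), 0 < p.1.2 & 0 < p.2]].

Let measurable_coords :
  [/\ measurable_fun setT (fun p : R * R * R => p.1.1),
    measurable_fun setT (fun p : R * R * R => p.1.2) &
    measurable_fun setT (fun p : R * R * R => p.2)].
Proof.
split; last exact: measurable_snd.
- exact: measurableT_comp measurable_fst measurable_fst.
- exact: measurableT_comp measurable_snd measurable_fst.
Qed.

Let measurable_resonance c n : measurable (resonance c n).
Proof.
have [m1 m2 m3] := measurable_coords.
pose h (p : R * R * R) : R := p.1.2 - c * (p.2 ^+ n * p.1.1).
have mh : measurable_fun setT h.
  apply: measurable_funB => //; apply: measurable_funM => //.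
  by apply: measurable_funM => //; exact: measurable_funX.
rewrite (_ : resonance c n = (h @^-1` [set 0]) `&`
  ((fun p => p.1.2) @^-1` `]0, +oo[%classic `&`
   (fun p => p.2) @^-1` `]0, +oo[%classic)).
  apply: measurableI; first by rewrite -[_ @^-1` _]setTI; exact: mh.
  apply: measurableI; rewrite -[_ @^-1` _]setTI.
    by apply: m2 => //; exact: measurable_itv.
  by apply: m3 => //; exact: measurable_itv.
apply/seteqP; split => p; rewrite /resonance /h /= !in_itv /= !andbT.
  by move=> [-> p0 q0]; rewrite subrr.
by move=> [/eqP + [p0 q0]]; rewrite subr_eq0 => /eqP.
Qed.

(* For n = 0 the section in the last variable may be everything. *)
Let resonance_negligible0 c :
  ((lambda \x lambda) \x lambda)%E.-negligible (resonance c 0).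
Proof.
pose h (p : R * R) : R := p.2 - c * p.1.
have mh : measurable_fun setT h.
  apply: measurable_funB; first exact: measurable_snd.
  by apply: measurable_funM => //; exact: measurable_fst.
pose S := h @^-1` [set 0].
have mS : measurable S by rewrite -[S]setTI; exact: mh.
exists (S `*` setT); split; first exact: measurableX.
  rewrite product_measure1E// [X in (X * _)%E](_ : _ = 0%E) ?mul0e//.
  apply: integral0_eq => d _ /=.
  rewrite (_ : xsection S d = [set c * d]) ?lebesgue_measure_set1//.
  apply/seteqP; split => a; rewrite /xsection /= !inE /S /h /=.
    by move=> /eqP; rewrite subr_eq0 => /eqP.
  by move=> ->; rewrite subrr.
by move=> p [/= E _ _]; split => //=; rewrite /S /h /= E expr0 mul1r subrr.
Qed.

(** For fixed d0 and a, at most one b > 0 solves the equation: a > 0 forces c d0 to be nonzero, and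
    positive powers are injective on positive numbers. *)
Let resonance_negligibleS c n :
  ((lambda \x lambda) \x lambda)%E.-negligible (resonance c n.+1).
Proof.
exists (resonance c n.+1); split => //; first exact: measurable_resonance.
apply: integral0_eq => q _ /=.
have [->|] := eqVneq (xsection (resonance c n.+1) q) set0; first exact: measure0.
move=> /set0P[b]; rewrite /xsection /= inE => -[/= E q0 b0].
rewrite (_ : [set _ | _] = [set b]) ?lebesgue_measure_set1//.
apply/seteqP; split => b' /=; rewrite inE; last by move=> ->.
move=> [/= E' _ b'0]; move: E'; rewrite E.
have cq : c * q.1 != 0.
  apply: contraTneq q0 => cq; rewrite E mulrCA cq mulr0 ltxx//.
rewrite ![c * (_ * q.1)]mulrCA => /(mulIf cq)/eqP.
by rewrite eqrXn2 ?ltW// => /eqP ->.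
Qed.

Lemma resonance_negligible (c : R) (n : nat) :
  ((lambda \x lambda) \x lambda)%E.-negligible (resonance c n).
Proof. by case: n => [|n];
  [exact: resonance_negligible0|exact: resonance_negligibleS]. Qed.

Lemma ae_params_nonresonant (J : countType) (c : J -> R) (P : R -> R -> R -> Prop) :
  (forall d0 a b, 0 < d0 -> 0 < a < 1 -> 0 < b < 1 ->
     (forall j n, a <> c j * (b ^+ n * d0)) -> P d0 a b) ->
  ae_params P.
Proof.
move=> H; rewrite /ae_params /almost_everywhere.
pose S (k : nat) := if @unpickle (J * nat)%type k is Some jn
  then resonance (c jn.1) jn.2 else set0.
have [A [mA A0 SA]] : ((lambda \x lambda) \x lambda)%E.-negligible (\bigcup_k S k).
  apply: negligible_bigcup => k; rewrite /S; case: unpickle => [[j n]|].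
    exact: resonance_negligible.
  exact: negligible_set0.
exists A; split => // p /= nP; apply: SA; apply: contrapT => nS.
apply: nP => h1 h2 h3; apply: H => // j n E.
apply: nS; exists (pickle (j, n)) => //; rewrite /S pickleK; split => //.
  by case/andP: h2.
by case/andP: h3.
Qed.

End AlmostEveryParameter.

(** * Trajectories *)

Section SingleStep.
Variables (R : realType) (n : nat) (f : 'rV[R]_n -> R) (r L : 'rV[R]_n -> R).
Variables (d0 a b : R).
Hypothesis f_C1 : Ck_on 1 setT f.
Hypotheses (r_gt0 : forall x, 0 < r x) (L_gt0 : forall x, 0 < L x).
Hypothesis f_lip : forall x, elipschitz_on (eball x (r x)) (L x) (grad f).
Hypotheses (d0_gt0 : 0 < d0) (a01 : 0 < a < 1) (b01 : 0 < b < 1).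

Let F := gd_update f r L d0 a b.

(** One quantity governs everything: times 1 - a it bounds the decrease of f from below, times d0 it
    bounds the squared length of the step from above, and where it vanishes so does the gradient. *)
Definition gd_drop (x : 'rV[R]_n) : R :=
  stepsize f r L d0 a b x * enorm (grad f x) ^+ 2.

Lemma gd_drop_ge0 x : 0 <= gd_drop x.
Proof.
by rewrite mulr_ge0 ?exprn_ge0 ?enorm_ge0// ltW// stepsize_gt0.
Qed.

Lemma gd_descent x : (1 - a) * gd_drop x <= f x - f (F x).
Proof.
rewrite lerBrDl -lerBrDr; apply: (gradient_descent (r := r x) (L := L x)) => //.
- by move=> y; exact: C1_differentiable.
- by rewrite ltW// stepsize_gt0.
- exact: ltW.
- by rewrite ltW// stepsize_lt_L.
- exact: stepsize_lt_r.
Qed.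

Lemma gd_step_le_drop x : enorm (F x - x) ^+ 2 <= d0 * gd_drop x.
Proof.
have s0 : 0 < stepsize f r L d0 a b x by exact: stepsize_gt0.
rewrite /F /gd_update addrAC subrr add0r enormN enormZ gtr0_norm// exprMn.
rewrite /gd_drop mulrA ler_wpM2r ?exprn_ge0 ?enorm_ge0// expr2 ler_pM2r//.
exact: stepsize_le.
Qed.

Hypotheses (r_cont : continuous r) (L_cont : continuous L).

(** If the gradient at [p] were nonzero, both it and the step size would be bounded below near [p],
    and so would the drop at infinitely many indices. *)
Lemma frequents_critical (u : nat -> 'rV[R]_n) p : frequents u p ->
  (forall e : R, 0 < e -> exists N, forall k, (N <= k)%N -> gd_drop (u k) < e) ->
  critical f p.
Proof.
move=> up drop0; apply/eqP; rewrite -enorm_eq0; apply/negPn/negP => gn0.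
set g := enorm (grad f p) in gn0.
have g0 : 0 < g by rewrite lt0r gn0 enorm_ge0.
have g20 : 0 < g / 2 by rewrite divr_gt0.
have gc : {for p, continuous (fun x => enorm (grad f x))}.
  apply: (@continuous_comp _ _ _ (grad f) (@enorm R n)).
    exact: C1_grad_continuous.
  exact: continuous_enorm.
have [e e0 he] := stepsize_locally_bounded_below r_gt0 L_gt0 d0_gt0 a01 b01
  r_cont L_cont (C1_grad_continuous f_C1) p.
have ng : \forall x \near p, g / 2 < enorm (grad f x).
  have /(@cvgrPdist_lt _ _ _ (nbhs p))/(_ _ g20) := gc.
  by apply: filterS => x; rewrite -/g ltr_norml; lra.
have eg0 : 0 < e * (g / 2) ^+ 2 by rewrite mulr_gt0// exprn_gt0.
have [N HN] := drop0 _ eg0.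
have [k Nk [ek gk]] := up _ (filterI he ng) N.
have := HN k Nk; rewrite ltNge => /negP; apply.
rewrite /gd_drop ler_pM ?exprn_ge0 ?(ltW e0) ?(ltW g20)//.
by rewrite lerXn2r ?nnegrE ?enorm_ge0 ?(ltW g20) ?(ltW gk).
Qed.

End SingleStep.

Section CoordinateWise.
Variables (R : realType) (m1 m2 : nat).
Variables (f : 'rV[R]_(m1 + m2) -> R) (f1 : 'rV[R]_m1 -> R) (f2 : 'rV[R]_m2 -> R).
Variables (r1 L1 : 'rV[R]_m1 -> R) (r2 L2 : 'rV[R]_m2 -> R) (d0 a b : R).
Hypothesis f_C1 : Ck_on 1 setT f.
Hypothesis f_split : forall x y, f (row_mx x y) = f1 x + f2 y.
Hypotheses (r1_cont : continuous r1) (L1_cont : continuous L1).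
Hypotheses (r2_cont : continuous r2) (L2_cont : continuous L2).
Hypotheses (r1_gt0 : forall x, 0 < r1 x) (L1_gt0 : forall x, 0 < L1 x).
Hypotheses (r2_gt0 : forall y, 0 < r2 y) (L2_gt0 : forall y, 0 < L2 y).
Hypothesis f1_lip : forall x, elipschitz_on (eball x (r1 x)) (L1 x) (grad f1).
Hypothesis f2_lip : forall y, elipschitz_on (eball y (r2 y)) (L2 y) (grad f2).
Hypotheses (d0_gt0 : 0 < d0) (a01 : 0 < a < 1) (b01 : 0 < b < 1).

Let F1 := gd_update f1 r1 L1 d0 a b.
Let F2 := gd_update f2 r2 L2 d0 a b.
Let f1_C1 : Ck_on 1 setT f1 := C1_split_l f_split f_C1.
Let f2_C1 : Ck_on 1 setT f2 := C1_split_r f_split f_C1.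

Lemma lsubmx_cw_gd z0 k :
  lsubmx (cw_gd f1 f2 r1 L1 r2 L2 d0 a b z0 k) = iter k F1 (lsubmx z0).
Proof. by elim: k => // k IH; rewrite /cw_gd iterS row_mxKl -/(cw_gd _ _ _ _ _
  _ _ _ _ _ _) IH. Qed.

Lemma rsubmx_cw_gd z0 k :
  rsubmx (cw_gd f1 f2 r1 L1 r2 L2 d0 a b z0 k) = iter k F2 (rsubmx z0).
Proof. by elim: k => // k IH; rewrite /cw_gd iterS row_mxKr -/(cw_gd _ _ _ _ _
  _ _ _ _ _ _) IH. Qed.

Lemma cw_gd_avoids_nonresonant_saddles :
  exists E : set 'rV[R]_(m1 + m2), lebesgue_null E /\
  forall z0, ~ E z0 -> forall p,
    cw_gd f1 f2 r1 L1 r2 L2 d0 a b z0 k @[k --> \oo] --> p -> gen_saddle f p ->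
    (forall k : nat, a / L1 (lsubmx p) <> b ^+ k * d0) ->
    (forall k : nat, a / L2 (rsubmx p) <> b ^+ k * d0) -> False.
Proof.
have [E1 [nE1 H1]] := gd_avoids_nonresonant_saddles f1_C1 r1_cont L1_cont
  r1_gt0 L1_gt0 f1_lip d0_gt0 a01 b01.
have [E2 [nE2 H2]] := gd_avoids_nonresonant_saddles f2_C1 r2_cont L2_cont
  r2_gt0 L2_gt0 f2_lip d0_gt0 a01 b01.
exists ([set z | E1 (lsubmx z)] `|` [set z | E2 (rsubmx z)]); split.
  by apply: lebesgue_nullU; [exact: lebesgue_null_lsubmx|exact: lebesgue_null_rsubmx].
move=> z0 /not_orP[nE1z nE2z] p cv; rewrite -[p in gen_saddle f p]hsubmxK.
move=> /(gen_saddle_split f_split)[sp nr _|sp _ nr].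
- apply: (H1 _ nE1z _ _ sp nr).
  rewrite (_ : (fun k => _) =
    (fun k => lsubmx (cw_gd f1 f2 r1 L1 r2 L2 d0 a b z0 k))).
    by apply: (cvg_comp _ _ cv); exact: lsubmx_continuous.
  by apply/funext => k; rewrite lsubmx_cw_gd.
- apply: (H2 _ nE2z _ _ sp nr).
  rewrite (_ : (fun k => _) =
    (fun k => rsubmx (cw_gd f1 f2 r1 L1 r2 L2 d0 a b z0 k))).
    by apply: (cvg_comp _ _ cv); exact: rsubmx_continuous.
  by apply/funext => k; rewrite rsubmx_cw_gd.
Qed.

Section Trajectory.
Variable z0 : 'rV[R]_(m1 + m2).
Let z := cw_gd f1 f2 r1 L1 r2 L2 d0 a b z0.
Let drop1 k := gd_drop f1 r1 L1 d0 a b (lsubmx (z k)).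
Let drop2 k := gd_drop f2 r2 L2 d0 a b (rsubmx (z k)).

Let zS k : z k.+1 = row_mx (F1 (lsubmx (z k))) (F2 (rsubmx (z k))).
Proof. by []. Qed.

Let drop1_ge0 k : 0 <= drop1 k. Proof. exact: gd_drop_ge0. Qed.
Let drop2_ge0 k : 0 <= drop2 k. Proof. exact: gd_drop_ge0. Qed.

Let a1 : 0 < 1 - a. Proof. by rewrite subr_gt0; case/andP: a01. Qed.

Let descent k : (1 - a) * (drop1 k + drop2 k) <= f (z k) - f (z k.+1).
Proof.
have h1 := gd_descent f1_C1 r1_gt0 L1_gt0 f1_lip d0_gt0 a01 b01 (lsubmx (z k)).
have h2 := gd_descent f2_C1 r2_gt0 L2_gt0 f2_lip d0_gt0 a01 b01 (rsubmx (z k)).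
have -> : f (z k) = f1 (lsubmx (z k)) + f2 (rsubmx (z k)).
  by rewrite -f_split hsubmxK.
rewrite zS f_split mulrDr.
by rewrite opprD addrACA; exact: lerD h1 h2.
Qed.

Let f_nonincr (j k : nat) : (j <= k)%N -> f (z k) <= f (z j).
Proof.
elim: k => [|k IH]; first by rewrite leqn0 => /eqP->.
rewrite leq_eqVlt => /orP[/eqP->//|]; rewrite ltnS => /IH; apply: le_trans.
rewrite -subr_ge0; apply: le_trans (descent k).
by rewrite mulr_ge0 ?(ltW a1)// addr_ge0.
Qed.

(** Since f decreases along the orbit and comes back arbitrarily close to f p, it never falls below
    f p. Its values therefore converge, and their consecutive differences dominate the drops. *)
Let drops_vanish p : frequents z p -> forall e : R, 0 < e ->
  exists N, forall k, (N <= k)%N -> drop1 k + drop2 k < e.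
Proof.
move=> zp e e0; have fc : {for p, continuous f}.
  by apply: differentiable_continuous; exact: C1_differentiable.
have lb k : f p <= f (z k).
  rewrite leNgt; apply/negP => lt.
  have /(@cvgrPdist_lt _ _ _ (nbhs p))/(_ (f p - f (z k))) := fc.
  rewrite subr_gt0 => /(_ lt) /zp /(_ k)[j kj].
  by have := f_nonincr kj; rewrite ltr_norml; lra.
have cv : cvg (f (z k) @[k --> \oo]).
  apply: nonincreasing_is_cvgn => [j k|]; first exact: f_nonincr.
  by exists (f p) => _ [k _ <-].
have e'0 : 0 < (1 - a) * e / 2 by rewrite divr_gt0// mulr_gt0.
have /cvgrPdist_lt/(_ _ e'0)[N _ HN] := cv.
exists N => k Nk; rewrite -(ltr_pM2l a1); apply: le_lt_trans (descent k) _.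
have := HN k Nk; have := HN k.+1 (leqW Nk); rewrite /= !ltr_norml.
move: (lim _) (f (z k)) (f (z k.+1)) => A B C; lra.
Qed.

Lemma cw_gd_steps_vanish p : frequents z p ->
  enorm (z k.+1 - z k) @[k --> \oo] --> (0 : R).
Proof.
move=> zp; apply/cvgrPdist_lt => e e0.
have e20 : 0 < e ^+ 2 / d0 by rewrite divr_gt0// exprn_gt0.
have [N HN] := drops_vanish zp e20; exists N => // k /= Nk.
rewrite sub0r normrN ger0_norm ?enorm_ge0//.
rewrite -(@ltr_pXn2r _ 2) ?nnegrE ?enorm_ge0 ?(ltW e0)//.
apply: (@le_lt_trans _ _ (d0 * (drop1 k + drop2 k))); last first.
  by rewrite mulrC -ltr_pdivlMr// HN.
have -> : z k.+1 - z k = row_mx (F1 (lsubmx (z k)) - lsubmx (z k))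
                                (F2 (rsubmx (z k)) - rsubmx (z k)).
  by rewrite -add_row_mx -opp_row_mx hsubmxK.
rewrite enorm_row_mx mulrDr.
by apply: lerD; exact: gd_step_le_drop.
Qed.

Lemma cw_gd_frequents_critical p : frequents z p -> critical f p.
Proof.
move=> zp; have vanish := drops_vanish zp.
rewrite -[p]hsubmxK; apply/(critical_split f_split); split.
- apply: (frequents_critical f1_C1 r1_gt0 L1_gt0 d0_gt0 a01 b01 r1_cont L1_cont
    (u := fun k => lsubmx (z k))).
    by move=> U Up N; exact: zp _ (lsubmx_continuous Up) N.
  move=> e /vanish[N HN]; exists N => k /HN; apply: le_lt_trans.
  by rewrite lerDl.
- apply: (frequents_critical f2_C1 r2_gt0 L2_gt0 d0_gt0 a01 b01 r2_cont L2_cont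
    (u := fun k => rsubmx (z k))).
    by move=> U Up N; exact: zp _ (rsubmx_continuous Up) N.
  move=> e /vanish[N HN]; exists N => k /HN; apply: le_lt_trans.
  by rewrite lerDr.
Qed.

(** Without convergence, some sphere inside the isolating neighbourhood would carry a cluster point,
    hence a second critical point. *)
Lemma cw_gd_cvg_isolated p : frequents z p -> isolated_critical f p ->
  z k @[k --> \oo] --> p.
Proof.
move=> zp ip; apply: contrapT => ncv.
have [e e0 He] := frequents_on_spheres zp (cw_gd_steps_vanish zp) ncv.
have [s s0 Hs] := nbhs_eballP ip.
pose d := Num.min e s / 2.
have m0 : 0 < Num.min e s by rewrite lt_min e0.
have d0' : 0 < d by rewrite divr_gt0.
have : d < Num.min e s by rewrite /d; lra.
rewrite lt_min => /andP[de ds].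
have [|q zq qd] := He d; first by rewrite d0'.
have qp : q = p.
  by apply: (Hs q); [rewrite /eball /= qd|exact: cw_gd_frequents_critical].
by move: qd; rewrite qp subrr enorm0 => /eqP; rewrite eq_sym gt_eqF.
Qed.

Lemma cw_gd_cvg_countable p : frequents z p ->
  countable [set q | critical f q] -> z k @[k --> \oo] --> p.
Proof.
move=> zp cC; apply: contrapT => ncv.
have [e e0 He] := frequents_on_spheres zp (cw_gd_steps_vanish zp) ncv.
have [d de Hd] := enorm_spheres_uncountable p cC e0.
by have [q zq] := He d de; apply: Hd; exact: cw_gd_frequents_critical.
Qed.

End Trajectory.

End CoordinateWise.

(** An isolated critical point is the only critical point in some basic set, so listing the basic
    sets lists all such points. *)
Lemma enumerate_isolated_critical (R : realType) (n : nat) (f : 'rV[R]_n -> R) :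
  exists q : nat -> 'rV[R]_n, forall p, critical f p -> isolated_critical f p ->
    exists k, q k = p.
Proof.
have [B hB] := exists_countable_basis R n.
pose good k p := [/\ B k p, critical f p & forall w, B k w -> critical f w -> w = p].
have /choice[q Hq] k : exists q, forall p, good k p -> q = p.
  have [[p gp]|np] := pselect (exists p, good k p); last first.
    by exists 0 => p gp; exfalso; apply: np; exists p.
  by exists p => p' [_ _]; apply; case: gp.
exists q => p cp ip; have [k [BU Bp]] := hB p _ ip; exists k; apply: Hq.
by split => //; exact: nbhs_singleton.
Qed.

Lemma elipschitz_on_le (R : realType) (m n : nat) (A : set 'rV[R]_m) (L L' : R)
    (g : 'rV[R]_m -> 'rV[R]_n) : L <= L' ->
  elipschitz_on A L g -> elipschitz_on A L' g.
Proof.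
move=> LL' h u v Au Av; apply: le_trans (h u v Au Av) _.
by rewrite ler_wpM2r// enorm_ge0.
Qed.

Lemma continuous_maxr_cst (R : realType) (n : nat) (L : 'rV[R]_n -> R) (c : R) :
  continuous L -> continuous (fun x => Num.max (L x) c).
Proof.
move=> cL x; apply: (@continuous_max _ _ L (fun=> c)); first exact: cL.
exact: cst_continuous.
Qed.

Lemma nonresonantP (R : realType) (a b d l : R) (k : nat) : 0 < l ->
  a <> l * (b ^+ k * d) -> a / l <> b ^+ k * d.
Proof. by move=> l0 h E; apply: h; rewrite -E mulrC divfK// gt_eqF. Qed.

Theorem theorem0p4 (R : realType) (m1 m2 : nat)
    (f : 'rV[R]_(m1 + m2) -> R) (f1 : 'rV[R]_m1 -> R) (f2 : 'rV[R]_m2 -> R)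
    (r1 L1 : 'rV[R]_m1 -> R) (r2 L2 : 'rV[R]_m2 -> R)
    (f_C1 : Ck_on 1 setT f)
    (f_split : forall x y, f (row_mx x y) = f1 x + f2 y)
    (r1_cont : continuous r1) (L1_cont : continuous L1)
    (r2_cont : continuous r2) (L2_cont : continuous L2)
    (r1_gt0 : forall x, 0 < r1 x) (L1_gt0 : forall x, 0 < L1 x)
    (r2_gt0 : forall y, 0 < r2 y) (L2_gt0 : forall y, 0 < L2 y)
    (f1_lip : forall x, elipschitz_on (eball x (r1 x)) (L1 x) (grad f1))
    (f2_lip : forall y, elipschitz_on (eball y (r2 y)) (L2 y) (grad f2))
    (gradf_C2 : forall z, gen_saddle f z -> grad_Ck_near 2 z f) :
  [/\ (forall (d0 a b : R) (z0 : 'rV[R]_(m1 + m2)),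
        0 < d0 -> 0 < a < 1 -> 0 < b < 1 ->
        let z := cw_gd f1 f2 r1 L1 r2 L2 d0 a b z0 in
        [/\ enorm (z n.+1 - z n) @[n --> \oo] --> (0 : R) \/
            enorm (z n) @[n --> \oo] --> +oo,
            (forall p, cluster_point z p -> critical f p) &
            countable [set p | critical f p] ->
            (exists p, critical f p /\ z n @[n --> \oo] --> p) \/
            enorm (z n) @[n --> \oo] --> +oo]),
      ae_params (fun d0 a b : R =>
        exists E1 : set 'rV[R]_(m1 + m2), lebesgue_null E1 /\
          forall z0, ~ E1 z0 ->
          forall p, cluster_point (cw_gd f1 f2 r1 L1 r2 L2 d0 a b z0) p ->
            ~ (gen_saddle f p /\ isolated_critical f p)) &
      (forall L0 : R, 0 < L0 ->
        (forall (x : 'rV[R]_m1) (y : 'rV[R]_m2),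
           gen_saddle f (row_mx x y) -> ~ isolated_critical f (row_mx x y) ->
           Num.max (L1 x) (L2 y) <= L0) ->
        ae_params (fun d0 a b : R =>
          (forall n : nat, a / L0 <> b ^+ n * d0) ->
          exists E2 : set 'rV[R]_(m1 + m2), lebesgue_null E2 /\
            forall z0, ~ E2 z0 ->
            let z' := cw_gd f1 f2 r1 (fun x => Num.max (L1 x) L0)
                                  r2 (fun y => Num.max (L2 y) L0) d0 a b z0 in
            forall p, z' n @[n --> \oo] --> p -> ~ gen_saddle f p))].
Proof.
have [q Hq] := enumerate_isolated_critical f.
pose J : countType := (nat * bool)%type.
split.
- move=> d0 a b z0 d0_gt0 a01 b01 z.
  have crit p : frequents z p -> critical f p.
    exact: (cw_gd_frequents_critical f_C1 f_split r1_cont L1_cont r2_cont L2_cont).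
  split.
  + have [[p zp]|] := frequents_or_diverges z; [left|by right].
    exact: (cw_gd_steps_vanish f_C1 f_split) zp.
  + by move=> p /cluster_frequents; exact: crit.
  + move=> cC; have [[p zp]|] := frequents_or_diverges z; [left|by right].
    exists p; split; first exact: crit.
    exact: (cw_gd_cvg_countable f_C1 f_split r1_cont L1_cont r2_cont L2_cont) zp cC.
(* The boolean selects the factor, as resonance must be avoided for [L1] and [L2] separately. *)
- apply: (@ae_params_nonresonant R J (fun kt =>
    if kt.2 then L1 (lsubmx (q kt.1)) else L2 (rsubmx (q kt.1)))).
  move=> d0 a b d0_gt0 a01 b01 nr.
  have [E [nE HE]] := cw_gd_avoids_nonresonant_saddles f_C1 f_split r1_cont
    L1_cont r2_cont L2_cont r1_gt0 L1_gt0 r2_gt0 L2_gt0 f1_lip f2_lip d0_gt0 a01 b01.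
  exists E; split => // z0 nEz p /cluster_frequents zp [sp ip].
  have cp : critical f p by case: sp.
  have [k qk] := Hq p cp ip.
  apply: (HE z0 nEz p _ sp) => [|j|j].
  + exact: (cw_gd_cvg_isolated f_C1 f_split r1_cont L1_cont r2_cont L2_cont) zp ip.
  + by apply: nonresonantP => //; rewrite -qk; exact: (nr (k, true) j).
  + by apply: nonresonantP => //; rewrite -qk; exact: (nr (k, false) j).
- move=> L0 L0_gt0 HL0.
  have Lmax_gt0 l : 0 < Num.max l L0 by rewrite lt_max L0_gt0 orbT.
  have Lmax_ge l : l <= Num.max l L0 by rewrite le_max lexx.
  apply: (@ae_params_nonresonant R J (fun kt =>
    if kt.2 then Num.max (L1 (lsubmx (q kt.1))) L0
    else Num.max (L2 (rsubmx (q kt.1))) L0)).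
  move=> d0 a b d0_gt0 a01 b01 nr nr0.
  have [E [nE HE]] := cw_gd_avoids_nonresonant_saddles f_C1 f_split r1_cont
    (continuous_maxr_cst (c := L0) L1_cont) r2_cont
    (continuous_maxr_cst (c := L0) L2_cont) r1_gt0 (fun x => Lmax_gt0 (L1 x))
    r2_gt0 (fun y => Lmax_gt0 (L2 y))
    (fun x => elipschitz_on_le (Lmax_ge (L1 x)) (f1_lip x))
    (fun y => elipschitz_on_le (Lmax_ge (L2 y)) (f2_lip y)) d0_gt0 a01 b01.
  exists E; split => // z0 nEz z' p cv sp.
  have cp : critical f p by case: sp.
  have [ip|nip] := pselect (isolated_critical f p).
  + have [k qk] := Hq p cp ip.
    apply: (HE z0 nEz p cv sp) => j; apply: nonresonantP => //; rewrite -qk.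
      exact: (nr (k, true) j).
    exact: (nr (k, false) j).
  (* Non-isolated saddles may be uncountable, but there both maxima equal [L0], so the single
     condition [nr0] excludes resonance at all of them. *)
  + have := HL0 (lsubmx p) (rsubmx p); rewrite hsubmxK => /(_ sp nip).
    rewrite ge_max => /andP[l1 l2].
    apply: (HE z0 nEz p cv sp) => j.
      by rewrite (max_idPr l1).
    by rewrite (max_idPr l2).
Qed.
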